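(* Let $k\ge1$ and $3\le N_1\le N_2\le\cdots\le N_{k+1}$. Then $$A_{k+1}(N_1,\dots,N_{k+1})\asymp_k H^{(k+1)}\left(N_1\cdots N_{k+1},\left(\frac{N_1}{2},\dots,\frac{N_k}{2}\right),(N_1,\dots,N_k)\right).$$
   Context: For real $N_1,\dots,N_{k+1}\ge1$, $A_{k+1}(N_1,\dots,N_{k+1})=|\{n_1\cdots n_{k+1}: n_i\in\mathbb{N},\ n_i\le N_i\ (1\le i\le k+1)\}|$, the number of distinct products. For $x\ge1$ and $\mathbf{y}=(y_1,\dots,y_k)$, $\mathbf{z}=(z_1,\dots,z_k)\in\mathbb{R}^k$, $H^{(k+1)}(x,\mathbf{y},\mathbf{z})$ is the number of positive integers $n\le x$ for which there exist positive integers $d_1,\dots,d_k$ with $d_1\cdots d_k\mid n$ and $y_i<d_i\le z_i$ for $1\le i\le k$. The notation $f\asymp_k g$ means $g\ll_k f\ll_k g$, with implied constants depending only on $k$. *)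

(* Defs.v *)
From HB Require Import structures.
From mathcomp Require Import all_boot all_order all_algebra.
From mathcomp Require Import reals.
Set Implicit Arguments. Unset Strict Implicit. Unset Printing Implicit Defensive.
Import Order.TTheory GRing.Theory Num.Theory.
Local Open Scope ring_scope.

Section Defs.
Variable R : realType.

(* A_m(N_1,...,N_m): number of distinct products n_1 ... n_m with
   n_i positive integers, n_i <= N_i.  Every such product is a natural
   number m with m <= N_1 ... N_m (when all N_i >= 1; otherwise the set is
   empty), hence m ranges over 0 .. floor(N_1...N_m); each n_i <= m. *)
Definition A_count (m : nat) (N : 'I_m -> R) : nat :=
  let B := Num.truncn (\prod_(i < m) N i) in
  count (fun p : nat =>
    [exists n : {ffun 'I_m -> 'I_B.+1},
       [forall i, (0 < (n i : nat))%N && ((n i : nat)%:R <= N i)]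
       && (p == \prod_(i < m) (n i : nat))%N])
    (iota 0 B.+1).

(* H^{(k+1)}(x, y, z): number of positive integers n <= x such that there
   exist positive integers d_1..d_k with d_1 ... d_k | n and y_i < d_i <= z_i.
   Such d_i divide n, hence d_i <= n. *)
Definition H_count (k : nat) (x : R) (y z : 'I_k -> R) : nat :=
  count (fun n : nat =>
    (0 < n)%N && (n%:R <= x) &&
    [exists d : {ffun 'I_k -> 'I_n.+1},
       [forall i, (0 < (d i : nat))%N && (y i < (d i : nat)%:R)
                  && ((d i : nat)%:R <= z i)]
       && (\prod_(i < k) (d i : nat) %| n)%N])
    (iota 0 (Num.truncn x).+1).

End Defs.

(* Main.v *)
(* For a set S of positive integers stable under multiples, let L(S, X) be the
   sum of 1/n over the n <= X in S.  Write n = d_1 ... d_k m, weigh n by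
   log m = sum_(b | m) Lambda(b) and delete b from m: with Chebyshev's bounds
   this shows that S has about X L(S, X) / log X elements up to X, and that
   doubling X changes L(S, X) by a bounded factor only.

   Let S_Y be the set of multiples of the products d_1 ... d_k with
   Y_i / 2 < d_i <= Y_i, where Y_i is the integer part of N_i.  The elements of
   S_Y up to 2^-k Y_1 ... Y_(k+1) are products counted by A, whence H << A.

   Conversely, a dyadic decomposition of the factors of a product reduces
   A << H to L(S_(Y / 2^a), X / 2^(a_1 + ... + a_k)) << prod_i (a_i + 2) L(S_Y, X).
   Here one exchanges a prime power b | d_i for a prime power of size about
   2^(a_i) b.  For a given cofactor, the admissible b fill a union of dyadic
   intervals, and the mass Lambda(b) / b of such a union hardly changes under
   dilation.  An n in S_Y is reached at most as often as the logarithm of its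
   Y_i-smooth part, which is O(log Y_i) on average over S_Y: a second moment
   argument bounds the average at scale T by the one at scale T^2, and for T
   larger than all Y_i the bound is clear. *)
Require Import Defs.
From HB Require Import structures.
From mathcomp Require Import all_boot all_order all_algebra.
From mathcomp Require Import boolp reals exp.
From mathcomp Require Import zify ring lra.
Set Implicit Arguments.
Unset Strict Implicit.
Unset Printing Implicit Defensive.
Import Order.TTheory GRing.Theory Num.Theory.
Local Open Scope ring_scope.

Section Factorizations.
Variable R : realType.

(** * Divisor sums and Chebyshev bounds *)

Section Mangoldt.
Implicit Types (b m n p T X : nat).

Lemma sum_multiples X b (F : nat -> R) : (0 < b)%N ->
  \sum_(1 <= n < X.+1 | (b %| n)%N) F n
  = \sum_(1 <= m < (X %/ b).+1) F (m * b)%N.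
Proof.
move=> b0; rewrite /index_iota !subn1 /= -big_filter -(big_map (muln^~ b) xpredT).
apply: perm_big; apply: uniq_perm.
- by rewrite filter_uniq // iota_uniq.
- rewrite map_inj_uniq ?iota_uniq // => x y /eqP.
  by rewrite eqn_pmul2r // => /eqP.
move=> n; rewrite mem_filter mem_iota; apply/andP/mapP.
- case=> /dvdnP[q ->] /andP[h1 h2]; exists q => //.
  have q0 : (0 < q)%N by case: q h1 {h2} => //; rewrite mul0n.
  by rewrite mem_iota q0 /= add1n ltnS leq_divRL //; lia.
- case=> m; rewrite mem_iota add1n ltnS leq_divRL // => /andP[h1 h2] ->.
  by rewrite dvdn_mull //; split=> //; nia.
Qed.

Lemma sum_hyperbola_sym X (F : nat -> nat -> R) :
  \sum_(1 <= b < X.+1) \sum_(1 <= m < (X %/ b).+1) F m b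
  = \sum_(1 <= m < X.+1) \sum_(1 <= b < (X %/ m).+1) F m b.
Proof.
have E a (G : nat -> R) : (0 < a)%N -> \sum_(1 <= m < (X %/ a).+1) G m
    = \sum_(1 <= m < X.+1 | (m * a <= X)%N) G m.
  move=> a0; rewrite (big_nat_widen _ _ X.+1) ?ltnS ?leq_div //.
  by apply: eq_bigl => i /=; rewrite ltnS leq_divRL.
rewrite (eq_big_nat _ _ (F2 := fun b =>
  \sum_(1 <= m < X.+1 | (m * b <= X)%N) F m b)) => [|b /andP[b0 _]]; last exact: E.
rewrite (exchange_big_dep xpredT) //=.
by apply: eq_big_nat => m /andP[m0 _]; rewrite E //; apply: eq_bigl => b; rewrite mulnC.
Qed.

Lemma sum_divisors X (F : nat -> nat -> R) :
  \sum_(1 <= n < X.+1) \sum_(1 <= b < X.+1 | (b %| n)%N) F (n %/ b)%N b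
  = \sum_(1 <= m < X.+1) \sum_(1 <= b < (X %/ m).+1) F m b.
Proof.
rewrite (exchange_big_dep xpredT) //= -sum_hyperbola_sym.
apply: eq_big_nat => b /andP[b0 _]; rewrite sum_multiples //.
by apply: eq_bigr => m _; rewrite mulnK.
Qed.

Lemma sum_nat_subset X Y (P Q : pred nat) (F G : nat -> R) : (X <= Y)%N ->
  (forall n, (0 < n)%N -> (n <= X)%N -> P n -> Q n) ->
  (forall n, (0 < n)%N -> (n <= Y)%N -> Q n -> 0 <= G n) ->
  (forall n, (0 < n)%N -> (n <= X)%N -> P n -> F n <= G n) ->
  \sum_(1 <= n < X.+1 | P n) F n <= \sum_(1 <= n < Y.+1 | Q n) G n.
Proof.
move=> XY PQ G0 FG.
rewrite (big_nat_widen _ _ Y.+1) ?ltnS // big_nat_cond [leRHS]big_nat_cond.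
rewrite [leLHS]big_mkcond [leRHS]big_mkcond; apply: ler_sum => n _.
case: ifP => [/andP[/andP[n0 nY] /andP[Pn nX]]|_]; last first.
  by case: ifP => // /andP[/andP[n0 nY] Qn]; apply: G0.
by rewrite n0 nY PQ //= FG.
Qed.

(** Von Mangoldt's function. At most one pair [(p, e)] contributes; as a double sum it can be
    exchanged with other sums without recognizing prime powers. *)
Definition mangoldt b : R :=
  \sum_(1 <= p < b.+1 | prime p) \sum_(1 <= e < b.+1 | (p ^ e == b)%N) ln p%:R.

Lemma ln_nat_ge0 n : 0 <= ln n%:R :> R.
Proof. by case: n => [|n]; [rewrite ln0|rewrite ln_ge0 // ler1n]. Qed.

Lemma ler_ln_nat m n : (0 < m)%N -> (m <= n)%N -> ln m%:R <= ln n%:R :> R.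
Proof.
by move=> m0 mn; rewrite ler_ln ?posrE ?ltr0n ?ler_nat //; apply: leq_trans mn.
Qed.

Lemma ln_natM m n : (0 < m)%N -> (0 < n)%N ->
  ln (m * n)%:R = ln m%:R + ln n%:R :> R.
Proof. by move=> m0 n0; rewrite natrM lnM // posrE ltr0n. Qed.

Lemma ln_natX m n : (0 < m)%N -> ln (m ^ n)%:R = ln m%:R *+ n :> R.
Proof. by move=> m0; rewrite natrX lnXn // ltr0n. Qed.

Lemma ln_prod_nat (I : Type) (r : seq I) (P : pred I) (F : I -> nat) :
  (forall i, P i -> (0 < F i)%N) ->
  ln (\prod_(i <- r | P i) F i)%:R = \sum_(i <- r | P i) ln (F i)%:R :> R.
Proof.
move=> F0; pose K (s : R) m := (0 < m)%N /\ ln m%:R = s.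
suff [] : K (\sum_(i <- r | P i) ln (F i)%:R) (\prod_(i <- r | P i) F i)%N by [].
apply: big_rec2; first by rewrite /K ln1.
move=> i m s Pi [m0 <-]; split; first by rewrite muln_gt0 F0.
by rewrite ln_natM ?F0.
Qed.

Lemma ln2_ge : 1/2 <= ln 2 :> R.
Proof.
have h : ln (1/2) <= - (1/2) :> R.
  have := @le_ln1Dx R (- (1/2)); rewrite (_ : 1 + - (1/2) = 1/2); last by lra.
  by apply; lra.
have : ln (1/2) = - ln 2 :> R by rewrite div1r lnV // posrE; lra.
lra.
Qed.

Lemma ln2_le : ln 2 <= 1 :> R.
Proof. by apply: (@le_ln1Dx R 1); lra. Qed.

Lemma ln_nat_ge_half n : (1 < n)%N -> 1/2 <= ln n%:R :> R.
Proof. by move=> n1; apply: le_trans ln2_ge _; apply: ler_ln_nat. Qed.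

Lemma mangoldt_ge0 b : 0 <= mangoldt b.
Proof. by apply: sumr_ge0 => p _; apply: sumr_ge0 => e _; apply: ln_nat_ge0. Qed.

(** A prime power up to [T] has base and exponent up to [T], so the same ranges serve every [b]. *)
Lemma sum_mangoldt T (g : nat -> R) :
  \sum_(1 <= b < T.+1) mangoldt b * g b
  = \sum_(1 <= p < T.+1 | prime p)
      \sum_(1 <= e < T.+1 | (p ^ e <= T)%N) ln p%:R * g (p ^ e)%N.
Proof.
have E b : (b <= T)%N -> mangoldt b =
    \sum_(1 <= p < T.+1 | prime p) \sum_(1 <= e < T.+1 | (p ^ e == b)%N) ln p%:R.
  move=> bT; rewrite /mangoldt (big_nat_widen _ _ T.+1) ?ltnS //.
  rewrite big_mkcondr; apply: eq_bigr => p p_pr /=.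
  have p1 := prime_gt1 p_pr.
  rewrite (big_nat_widen _ b.+1 T.+1) ?ltnS //.
  rewrite (@eq_bigl _ _ _ _ _ _ (fun e => (p ^ e == b)%N)); last first.
    move=> e /=; case: eqP => //= <-; rewrite ltnS.
    by rewrite ltnW // ltn_expl.
  case: ifP => // /negbT; rewrite -ltnNge => bp.
  rewrite big_nat_cond big1 // => e /andP[/andP[e0 _] /eqP pe].
  by move: bp; rewrite -pe -{2}(expn1 p) ltn_exp2l // ltnNge e0.
under eq_big_nat => b /andP[_ hb].
  rewrite E // mulr_suml; under eq_bigr => p _ do rewrite mulr_suml big_mkcond /=.
  over.
rewrite exchange_big /=; apply: eq_bigr => p p_pr.
rewrite exchange_big /= [RHS]big_mkcond; apply: eq_big_nat => e _ /=.
under eq_bigr => b _ do rewrite eq_sym.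
by rewrite -big_mkcond big_nat1_eq ltnS expn_gt0 prime_gt0.
Qed.

(* The logarithm of the largest divisor of [n] whose prime power factors are all
   at most [T]. *)
Definition smoothln T n : R := \sum_(1 <= b < T.+1 | (b %| n)%N) mangoldt b.

Definition psi n : R := \sum_(1 <= b < n.+1) mangoldt b.

(** Counting exponents prime by prime reduces questions on [smoothln] to [p]-adic valuations capped
    at [trunc_log p T]. *)
Lemma smoothlnE T n : smoothln T n = \sum_(1 <= p < T.+1 | prime p)
   ln p%:R *+ \sum_(1 <= e < T.+1) ((p ^ e <= T) && (p ^ e %| n))%N.
Proof.
rewrite /smoothln big_mkcond /=.
transitivity (\sum_(1 <= b < T.+1) mangoldt b * (b %| n)%N%:R).
  by apply: eq_bigr => b _; case: (b %| n)%N; rewrite ?mulr1 ?mulr0.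
rewrite sum_mangoldt; apply: eq_bigr => p p_pr.
rewrite -sumrMnr big_mkcond; apply: eq_bigr => e _ /=.
by case: leqP; case: dvdnP => _ //=; rewrite ?mulr1 ?mulr0.
Qed.

Lemma smoothln_ge0 T n : 0 <= smoothln T n.
Proof. by apply: sumr_ge0 => b _; apply: mangoldt_ge0. Qed.

Lemma smoothln_leT T U n : (T <= U)%N -> smoothln T n <= smoothln U n.
Proof. by move=> TU; apply: sum_nat_subset => // *; apply: mangoldt_ge0. Qed.

Lemma smoothln_id n : (0 < n)%N -> smoothln n n = ln n%:R.
Proof.
move=> n0; rewrite smoothlnE.
transitivity (\sum_(1 <= p < n.+1 | prime p) ln (p ^ logn p n)%:R : R).
  apply: eq_bigr => p p_pr; rewrite ln_natX ?prime_gt0 //; congr (_ *+ _).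
  (* [logn_count_dvd] stops before the exponent [e = n], which contributes nothing because
     [p ^ n > n]. *)
  rewrite logn_count_dvd // big_nat_recr //= [X in (_ + X)%N](_ : _ = 0%N); last first.
    case: leqP => //= h; have := leq_ltn_trans h (ltn_expl n (prime_gt1 p_pr)).
    by rewrite ltnn.
  rewrite addn0; apply: eq_bigr => e _; case: (boolP (p ^ e %| n)%N) => h; last by rewrite andbF.
  by rewrite dvdn_leq.
rewrite -{3}(partnT n0) /partn ln_prod_nat; last first.
  by move=> p _; rewrite expn_gt0; case: p.
rewrite [RHS]big_ltn_cond // expn0 ln1 add0r [LHS]big_mkcond; apply: eq_big => // p _.
by case: ifP => // p_pr; rewrite /logn p_pr ln1.
Qed.

Lemma smoothln_ge T n : (0 < n)%N -> (n <= T)%N -> smoothln T n = ln n%:R.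
Proof.
move=> n0 nT; rewrite -smoothln_id // /smoothln [RHS](big_nat_widen _ _ T.+1) //.
apply: eq_bigl => b; case: (boolP (b %| n)%N) => // bn.
by rewrite /= ltnS dvdn_leq.
Qed.

Lemma smoothln_le_ln T n : (0 < n)%N -> smoothln T n <= ln n%:R.
Proof.
move=> n0; rewrite -(@smoothln_ge (maxn T n)) ?leq_maxr //.
by apply: smoothln_leT; rewrite leq_maxl.
Qed.

(** The valuation at [p] is capped at [trunc_log p T], and the cap of a sum is at most the sum of
    the capped terms. *)
Lemma smoothlnM T m n : (0 < m)%N -> (0 < n)%N ->
  smoothln T (m * n) <= smoothln T m + smoothln T n.
Proof.
move=> m0 n0; rewrite !smoothlnE -big_split /=; apply: ler_sum => p p_pr.
rewrite -mulrnDr -[leLHS]mulr_natr -[leRHS]mulr_natr ler_wpM2l ?ln_nat_ge0 // ler_nat.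
have sumc c U : (c <= U)%N -> (\sum_(1 <= e < U.+1) (e <= c))%N = c.
  elim: U => [|U IH]; first by rewrite leqn0 => /eqP ->; rewrite big_geq.
  rewrite leq_eqVlt big_nat_recr //= => /orP[/eqP ->|cU].
    rewrite leqnn (eq_big_nat _ _ (F2 := fun=> 1%N)); last first.
      by move=> e /andP[_ h]; rewrite ltnW.
    by rewrite sum_nat_const_nat muln1 subn1 addn1.
  by rewrite IH // leqNgt cU addn0.
have E a : (0 < a)%N -> (0 < T)%N ->
    (\sum_(1 <= e < T.+1) ((p ^ e <= T) && (p ^ e %| a))
    = minn (logn p a) (trunc_log p T))%N.
  move=> a0 T0; have p1 := prime_gt1 p_pr.
  have tT : (trunc_log p T <= T)%N.
    by apply: leq_trans (trunc_logP p1 T0); rewrite ltnW // ltn_expl.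
  rewrite -[RHS](sumc _ T) ?geq_min ?tT ?orbT //; apply: eq_bigr => e _.
  rewrite pfactor_dvdn // leq_min andbC; congr (nat_of_bool (_ && _)).
  apply/idP/idP => [|h]; first exact: trunc_log_max.
  by apply: leq_trans (trunc_logP p1 T0); rewrite leq_exp2l.
case: (posnP T) => [->|T0]; first by rewrite !big_geq.
by rewrite !E ?muln_gt0 ?m0 // lognM //; lia.
Qed.

(** * Chebyshev's bounds for [psi], from factorials *)

Lemma ln_fact n : ln n`!%:R = \sum_(1 <= b < n.+1) mangoldt b * (n %/ b)%:R :> R.
Proof.
rewrite fact_prod big_nat_cond ln_prod_nat -?big_nat_cond; last by move=> i /andP[/andP[]].
rewrite (eq_big_nat _ _ (F2 := fun m => smoothln n m)); last first.
  by move=> m /andP[m0 mn]; rewrite smoothln_ge.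
rewrite /smoothln (exchange_big_dep xpredT) //=.
apply: eq_big_nat => b /andP[b0 _]; rewrite sum_multiples //.
by rewrite sumr_const_nat subn1 mulr_natr.
Qed.

(** These are bounds on the central binomial coefficient, cleared of division: from [n] to [n + 1]
    it grows by the factor [2 (2 n + 1) / (n + 1)], which lies between 2 and 4. *)
Lemma double_fact_bounds n :
  (2 ^ n * n`! ^ 2 <= (2 * n)`!)%N /\ ((2 * n)`! <= 4 ^ n * n`! ^ 2)%N.
Proof.
elim: n => [|n [IH1 IH2]] //; rewrite (_ : 2 * n.+1 = (2 * n).+2)%N; last by lia.
rewrite !factS !expnS !expn0 !muln1 in IH1 IH2 *.
move: (2 * n)`! (n`!) (2 ^ n)%N (4 ^ n)%N IH1 IH2 => A B C D IH1 IH2.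
split.
  apply: (@leq_trans ((2 * n).+2 * (2 * n).+1 * (C * (B * B)))%N); last by rewrite -mulnA !leq_mul.
  rewrite (_ : (2 * C * (n.+1 * B * (n.+1 * B)) = (2 * n.+1 * n.+1) * (C * (B * B)))%N); last by ring.
  by rewrite leq_mul //; nia.
apply: (@leq_trans ((2 * n).+2 * (2 * n).+1 * (D * (B * B)))%N); first by rewrite -mulnA !leq_mul.
rewrite (_ : (4 * D * (n.+1 * B * (n.+1 * B)) = (4 * n.+1 * n.+1) * (D * (B * B)))%N); last by ring.
by rewrite leq_mul //; nia.
Qed.

Lemma psi_le_psi m n : (m <= n)%N -> psi m <= psi n.
Proof. by move=> mn; apply: sum_nat_subset => // *; apply: mangoldt_ge0. Qed.

(** The logarithm of the central binomial coefficient. The truncated subtraction is exact, and its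
    value is 0 or 1, with 1 for [n < b <= 2 n]: hence both bounds below. *)
Lemma ln_double_fact n : ln (2 * n)`!%:R - 2 * ln n`!%:R =
  \sum_(1 <= b < (2 * n).+1) mangoldt b * ((2 * n) %/ b - 2 * (n %/ b))%:R :> R.
Proof.
have -> : ln n`!%:R = \sum_(1 <= b < (2 * n).+1) mangoldt b * (n %/ b)%:R :> R.
  rewrite ln_fact [RHS](big_cat_nat (n := n.+1)) //=; last by lia.
  rewrite [X in _ = _ + X]big_nat_cond [X in _ = _ + X]big1 ?addr0 // => b.
  by move=> /andP[/andP[nb _] _]; rewrite divn_small ?mulr0.
rewrite ln_fact mulr_sumr -sumrB; apply: eq_big_nat => b /andP[b0 _].
rewrite natrB; first by rewrite natrM; ring.
by rewrite leq_divRL //; have := leq_divM n b; lia.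
Qed.

Lemma psi_double_upper n : psi (2 * n) <= psi n + 2 * n%:R * ln 2.
Proof.
have h : psi (2 * n) - psi n <= ln (2 * n)`!%:R - 2 * ln n`!%:R.
  rewrite ln_double_fact /psi lerBlDl.
  rewrite (big_cat_nat (n := n.+1)) //=; last by lia.
  rewrite lerD2l [leRHS](big_cat_nat (n := n.+1)) //=; last by lia.
  apply: ler_wpDl.
    by apply: sumr_ge0 => b _; rewrite mulr_ge0 ?mangoldt_ge0.
  apply: ler_sum_nat => b /andP[nb b2].
  rewrite (divn_small nb) muln0 subn0 ler_peMr ?mangoldt_ge0 // ler1n divn_gt0; lia.
have := (double_fact_bounds n).2.
move=> /(ler_ln_nat (fact_gt0 _)); rewrite ln_natM ?expn_gt0 ?fact_gt0 // !ln_natX ?fact_gt0 //.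
rewrite (_ : ln 4%:R = 2 * ln 2 :> R); last first.
  by rewrite (_ : 4%N = (2 ^ 2)%N) // ln_natX // mulr2n; ring.
rewrite -(mulr_natl (2 * _)) -(mulr_natl (ln _)) => h2.
lra.
Qed.

Lemma psi_double_lower n : n%:R * ln 2 <= psi (2 * n).
Proof.
have h : ln (2 * n)`!%:R - 2 * ln n`!%:R <= psi (2 * n).
  rewrite ln_double_fact /psi; apply: ler_sum_nat => b /andP[b0 _].
  rewrite ler_piMr ?mangoldt_ge0 // (_ : 1 = 1%:R :> R) // ler_nat leq_subLR.
  rewrite -ltnS -(ltn_pmul2r b0).
  apply: leq_ltn_trans (leq_divM _ _) _.
  by have := divn_eq n b; have := ltn_pmod n b0; nia.
have := (double_fact_bounds n).1.
move=> /(ler_ln_nat _) => /(_ _); rewrite ln_natM ?expn_gt0 ?fact_gt0 // !ln_natX ?fact_gt0 //.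
rewrite muln_gt0 expn_gt0 sqrn_gt0 fact_gt0 => /(_ isT).
rewrite -(mulr_natl (ln 2)) -(mulr_natl (ln _) 2) => h2.
lra.
Qed.

Lemma psi1 : psi 1 = 0.
Proof. by rewrite /psi big_nat1 /mangoldt big_nat_cond big1 // => -[|[|p]] // /andP[]. Qed.

Lemma psi_le n : psi n <= 4 * n%:R.
Proof.
have [m] := ubnP n; elim: m n => // m IH n nm.
case: (leqP n 1) => n1.
  by apply: le_trans (psi_le_psi n1) _; rewrite psi1 mulr_ge0.
(* With [q] equal to [n / 2] rounded up, [psi n <= psi q + 2 q <= 6 q <= 4 n]. *)
have [q [qn nq h]] : exists q, [/\ (q < n)%N, (n <= 2 * q)%N & (3 * q <= 2 * n)%N].
  by exists (n.+1 %/ 2)%N; split; lia.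
apply: le_trans (psi_le_psi nq) (le_trans (psi_double_upper q) _).
have := IH q; rewrite (leq_trans qn) // => /(_ isT) {}IH.
have : 2 * q%:R * ln 2 <= 2 * q%:R :> R by rewrite ler_piMr ?mulr_ge0 ?ln2_le.
have : (3 * q)%:R <= (2 * n)%:R :> R by rewrite ler_nat.
rewrite !natrM; lra.
Qed.

Lemma psi_ge n : (1 < n)%N -> n%:R / 6 <= psi n.
Proof.
move=> n1; have h : (2 * (n %/ 2) <= n)%N by lia.
apply: le_trans (psi_le_psi h); apply: le_trans (psi_double_lower _).
have : n%:R <= (3 * (n %/ 2))%:R :> R by rewrite ler_nat; lia.
have := ln2_ge; rewrite natrM; have : 0 <= (n %/ 2)%:R :> R by [].
by move: ((n %/ 2)%:R : R) => q; nra.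
Qed.

(** Mertens' upper bound: after multiplication by [T], replacing [T / b] by [T %/ b + 1] gives
    [ln T!] plus [psi T]. The constant 9 absorbs [psi T <= 4 T], because [ln T >= 1/2]. *)
Lemma sum_mangoldt_div T : (1 < T)%N ->
  \sum_(1 <= b < T.+1) mangoldt b / b%:R <= 9 * ln T%:R.
Proof.
move=> T1; have T0 : 0 < T%:R :> R by rewrite ltr0n; lia.
rewrite -(ler_pM2l T0).
apply: (@le_trans _ _ (ln T`!%:R + psi T)); last first.
  have h1 : ln T`!%:R <= T%:R * ln T%:R :> R.
    rewrite fact_prod big_nat_cond ln_prod_nat -?big_nat_cond; last by move=> i /andP[/andP[]].
    apply: le_trans (_ : \sum_(1 <= i < T.+1) ln T%:R <= _).
      by apply: ler_sum_nat => i /andP[i0 iT]; apply: ler_ln_nat.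
    by rewrite sumr_const_nat subn1 mulr_natl.
  have h2 := psi_le T; have h3 := ln_nat_ge_half T1.
  by nra.
rewrite ln_fact /psi -big_split mulr_sumr /=; apply: ler_sum_nat => b /andP[b0 _].
rewrite -[X in _ + X]mulr1 -mulrDr mulrCA ler_wpM2l ?mangoldt_ge0 //.
rewrite ler_pdivrMr ?ltr0n // natr1 -natrM ler_nat ltnW //.
exact: ltn_ceil.
Qed.

End Mangoldt.

(** * Reciprocal sums over sets of multiples *)

Section Multiples.
Implicit Types (b m n e T X Q M : nat) (S : pred nat).

Definition recsum S X : R := \sum_(1 <= n < X.+1 | S n) n%:R^-1.
Definition card_upto S X : R := \sum_(1 <= n < X.+1 | S n) 1.

Definition mult_closed S :=
  forall n m, (0 < n)%N -> (0 < m)%N -> S n -> S (n * m)%N.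
(** With [mult_closed], the set is generated by its members up to [Q]. An [n] well beyond [Q] then
    has a large cofactor [n / e], whose prime powers can be deleted without leaving the set. *)
Definition generated_below S Q :=
  forall n, (0 < n)%N -> S n -> exists e, [/\ S e, (e %| n)%N & (e <= Q)%N].

Lemma recsum_ge0 S X : 0 <= recsum S X.
Proof. by apply: sumr_ge0 => n _; rewrite invr_ge0. Qed.

Lemma recsum_le S X Y : (X <= Y)%N -> recsum S X <= recsum S Y.
Proof. by move=> XY; apply: sum_nat_subset => // *; rewrite invr_ge0. Qed.

Lemma card_upto_ge0 S X : 0 <= card_upto S X.
Proof. exact: sumr_ge0. Qed.

Lemma card_upto_le S X Y : (X <= Y)%N -> card_upto S X <= card_upto S Y.
Proof. by move=> XY; apply: sum_nat_subset. Qed.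

Lemma natr_divn_le X m : (X %/ m)%:R <= X%:R * m%:R^-1 :> R.
Proof.
case: (posnP m) => [->|m0]; first by rewrite divn0 invr0 mulr0.
by rewrite ler_pdivlMr ?ltr0n // -natrM ler_nat leq_divM.
Qed.

(** Deleting a prime power of the cofactor leaves [e] intact, so [n / b] is still a multiple of
    [e]. *)
Lemma smoothln_cofactor_le S T n e : mult_closed S -> (0 < n)%N -> S e -> (e %| n)%N ->
  smoothln T (n %/ e)
  <= \sum_(1 <= b < T.+1 | (b %| n)%N && S (n %/ b)%N) mangoldt b :> R.
Proof.
move=> Sm n0 Se /dvdnP[q nE]; move: n0; rewrite {}nE.
rewrite muln_gt0 => /andP[q0 e0]; rewrite mulnK //.
apply: sum_nat_subset => // [b b0 _ /dvdnP[r qE]|b *]; last exact: mangoldt_ge0.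
have r0 : (0 < r)%N by case: r qE q0 => // ->; rewrite mul0n.
rewrite qE mulnAC dvdn_mull //= mulnK // mulnC.
exact: Sm.
Qed.

Lemma ln_cofactor_le S X n e : mult_closed S -> (0 < n <= X)%N -> S e -> (e %| n)%N ->
  ln (n %/ e)%:R <= \sum_(1 <= b < X.+1 | (b %| n)%N && S (n %/ b)%N) mangoldt b :> R.
Proof.
move=> Sm /andP[n0 nX] Se en; rewrite -(@smoothln_ge X).
- exact: smoothln_cofactor_le.
- by rewrite divn_gt0 ?(dvdn_leq n0 en) // (dvdn_gt0 n0 en).
- exact: leq_trans (leq_div _ _) nX.
Qed.

Lemma sum_cofactors S X :
  \sum_(1 <= n < X.+1) \sum_(1 <= b < X.+1 | (b %| n)%N && S (n %/ b)%N) mangoldt b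
  = \sum_(1 <= m < X.+1 | S m) psi (X %/ m) :> R.
Proof.
under eq_bigr => n _ do rewrite big_mkcondr.
rewrite (@sum_divisors X (fun m b => if S m then mangoldt b else 0)).
rewrite [RHS]big_mkcond; apply: eq_bigr => m _; case: ifP => // _.
by rewrite big1.
Qed.

(** For [m > X / 2] the weight is [psi 1 = 0], so the right-hand sum may stop at [X / 2]. This
    halving is the source of [recsum_double]. *)
Lemma sum_cofactors_le S X :
  \sum_(1 <= n < X.+1) \sum_(1 <= b < X.+1 | (b %| n)%N && S (n %/ b)%N) mangoldt b
  <= 4 * X%:R * recsum S (X %/ 2).
Proof.
rewrite sum_cofactors mulr_sumr (big_nat_widen _ (X %/ 2).+1 X.+1); last by lia.
rewrite [leRHS]big_mkcondr [leLHS]big_nat_cond [leRHS]big_nat_cond.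
apply: ler_sum => m /andP[/andP[m0 mX] _] /=.
case: ifP => [|/negbT] h.
  rewrite -mulrA; apply: le_trans (psi_le _) _.
  by rewrite ler_wpM2l // natr_divn_le.
have : (X %/ m <= 1)%N by rewrite -ltnS ltn_divLR //; lia.
by move=> /psi_le_psi h'; apply: le_trans (h') _; rewrite psi1.
Qed.

(** Each [n] of [S] in [(X, 2 X]] has a cofactor [n / e >= 2], hence weight at least 1/2, while the
    total weight up to [2 X] is at most [8 X] times [recsum S X]. So there are at most [16 X] times
    [recsum S X] such [n], each with [1 / n <= 1 / X]; and [17 = 1 + 16]. *)
Lemma recsum_double S Q X : mult_closed S -> generated_below S Q -> (Q <= X)%N ->
  recsum S (2 * X) <= 17 * recsum S X.
Proof.
move=> Sm Sg QX; case: (posnP X) => [->|X0].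
  by rewrite muln0 ler_peMl ?recsum_ge0 //; lra.
have X0R : 0 < X%:R :> R by rewrite ltr0n.
rewrite /recsum (big_cat_nat (n := X.+1)) //=; last by lia.
rewrite -/(recsum S X) (_ : 17 = 1 + 16) ?mulrDl ?mul1r; last by lra.
rewrite lerD2l.
have := sum_cofactors_le S (2 * X); rewrite mulKn // natrM => h.
rewrite -(ler_pM2l X0R).
apply: (@le_trans _ _ (2 * (4 * (2 * X%:R) * recsum S X))); last by lra.
apply: le_trans (ler_wpM2l _ h) => //.
rewrite mulr_sumr [in leRHS](big_cat_nat (n := X.+1)) //=; last by lia.
rewrite mulrDr; apply: ler_wpDl.
  by rewrite mulr_ge0 // sumr_ge0 // => n _; rewrite sumr_ge0 // => b _; apply: mangoldt_ge0.
rewrite mulr_sumr [leLHS]big_mkcond; apply: ler_sum_nat => n /andP[Xn nX].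
have n0 : (0 < n)%N by apply: leq_trans Xn.
case: ifP => Sn; last first.
  by rewrite mulr_ge0 // sumr_ge0 // => b _; apply: mangoldt_ge0.
have [e [Se en eQ]] := Sg n n0 Sn.
apply: le_trans (_ : 1 <= _).
  by rewrite ler_pdivrMr ?ltr0n // mul1r ler_nat ltnW.
have := @ln_cofactor_le S (2 * X) n e Sm; rewrite n0 -ltnS nX => /(_ isT Se en) h1.
have : 1/2 <= ln (n %/ e)%:R :> R.
  apply: ln_nat_ge_half; rewrite ltn_divRL // mul1n.
  by apply: leq_ltn_trans Xn; apply: leq_trans QX.
lra.
Qed.

Lemma recsum_pow2 S Q X j : mult_closed S -> generated_below S Q -> (Q <= X)%N ->
  recsum S (2 ^ j * X) <= 17 ^+ j * recsum S X.
Proof.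
move=> Sm Sg QX; elim: j => [|j IH]; first by rewrite expr0 mul1n mul1r.
rewrite expnS -mulnA exprS -mulrA.
apply: le_trans (recsum_double Sm Sg _) _; last by rewrite ler_wpM2l.
by apply: leq_trans QX _; rewrite leq_pmull // expn_gt0.
Qed.

(** From [M e <= X] follows [ln M <= ln (X / n) + ln (n / e)]. Summed over [S], the first term is
    bounded through [ln x < x] and gives 1 of the 5, the second gives 4 by [sum_cofactors_le]. *)
Lemma card_upto_upper S Q X M : mult_closed S -> generated_below S Q ->
  (0 < M)%N -> (Q * M <= X)%N ->
  card_upto S X * ln M%:R <= 5 * X%:R * recsum S X.
Proof.
move=> Sm Sg M0 QX.
rewrite (_ : 5 * _ * _ = X%:R * recsum S X + 4 * X%:R * recsum S X); last by lra.
apply: (@le_trans _ _ (X%:R * recsum S X + 4 * X%:R * recsum S (X %/ 2))); last first.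
  by rewrite lerD2l ler_wpM2l ?mulr_ge0 // recsum_le // leq_div.
apply: le_trans (lerD (lexx _) (sum_cofactors_le S X)).
rewrite /card_upto /recsum mulr_suml mulr_sumr [leLHS]big_mkcond [X in _ <= X + _]big_mkcond.
rewrite -big_split; apply: ler_sum_nat => n /andP[n0 nX] /=.
case: ifP => Sn; last first.
  by rewrite add0r sumr_ge0 // => b _; apply: mangoldt_ge0.
have [e [Se en eQ]] := Sg n n0 Sn.
have := @ln_cofactor_le S X n e Sm; rewrite n0 -ltnS nX => /(_ isT Se en) h1.
apply: le_trans (lerD (lexx _) h1).
have e0 := dvdn_gt0 n0 en.
have X0 : (0 < X)%N by apply: leq_trans n0 _.
have Xn0 : 0 < X%:R * n%:R^-1 :> R by rewrite mulr_gt0 ?invr_gt0 ?ltr0n.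
have ne0 : (0 < n %/ e)%N by rewrite divn_gt0 // dvdn_leq.
rewrite mul1r; apply: (@le_trans _ _ (ln (X%:R * n%:R^-1) + ln (n %/ e)%:R)); last first.
  by rewrite lerD2r ltW // ln_sublinear.
have q0R : 0 < (n %/ e)%:R :> R by rewrite ltr0n.
have M0R : 0 < M%:R :> R by rewrite ltr0n.
rewrite -lnM ?posrE // ler_ln ?posrE ?(mulr_gt0 Xn0 q0R) //.
rewrite mulrAC ler_pdivlMr ?ltr0n // -!natrM ler_nat.
move: en => /dvdnP[q nE]; rewrite nE mulnK //.
apply: leq_trans (leq_mul QX (leqnn q)).
by rewrite (_ : (M * (q * e) = e * M * q)%N) ?leq_mul //; ring.
Qed.

(** Here [X / m <= 2 (X %/ m) <= 12 psi (X %/ m) + 2], where the 2 covers a quotient equal to 1. The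
    [psi] terms count the members [n] of [S] with weight at most [ln n]. *)
Lemma card_upto_lower S X : mult_closed S ->
  X%:R * recsum S X <= (12 * ln X%:R + 2) * card_upto S X.
Proof.
move=> Sm.
apply: (@le_trans _ _ (\sum_(1 <= m < X.+1 | S m) (12 * psi (X %/ m) + 2))).
  rewrite mulr_sumr [leLHS]big_nat_cond [leRHS]big_nat_cond; apply: ler_sum => m /andP[/andP[m0 mX] _].
  rewrite ltnS in mX; have q0 : (0 < X %/ m)%N by rewrite divn_gt0.
  apply: (@le_trans _ _ (2 * (X %/ m)%:R)).
    rewrite ler_pdivrMr ?ltr0n // -!natrM ler_nat.
    by have := ltn_ceil X m0; nia.
  have [q1|q1] := ltnP 1 (X %/ m)%N; first by have := @psi_ge _ q1; lra.
  have -> : (X %/ m)%N = 1%N by lia.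
  by rewrite psi1; lra.
rewrite big_split mulrDl; apply: lerD; last first.
  by rewrite /card_upto mulr_sumr; apply: ler_sum => m _; rewrite mulr1.
rewrite -mulr_sumr -mulrA ler_wpM2l //.
rewrite -sum_cofactors /card_upto mulr_sumr [leRHS]big_mkcond.
apply: ler_sum_nat => n /andP[n0 nX] /=; rewrite mulr1; case: ifP => Sn.
  apply: (@le_trans _ _ (ln n%:R)); last exact: ler_ln_nat.
  rewrite -(@smoothln_ge X) //; apply: sum_nat_subset => // [b _ _ /andP[]//|b *].
  exact: mangoldt_ge0.
rewrite big_nat_cond big_pred0 // => b; apply: contraFF Sn.
move=> /andP[/andP[b0 _] /andP[/dvdnP[q nE]]]; rewrite nE mulnK // => Sq.
by apply: Sm => //; case: q nE n0 {Sq} => // ->; rewrite mul0n.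
Qed.

End Multiples.

(** * Exchanging prime powers inside one coordinate *)

Section Transfer.
Implicit Types (a b c d e i j m n r s T U X Y Z : nat) (S : pred nat).

Definition dyadic Y d := (d <= Y < 2 * d)%N.

(* [D] stands for the set of products of the remaining coordinates. *)
Definition multiples (D : nat -> Prop) Y : pred nat := fun n =>
  `[< exists e d, [/\ D e, dyadic Y d & (e * d %| n)%N] >].

(** Relates a member [n * b] of [multiples D Y] to what is left once [b] is deleted from its
    coordinate [d * b]. Only the scale of [b] is recorded, so that a prime power of another size can
    be inserted instead. *)
Definition hit (D : nat -> Prop) Y X i n : bool :=
  `[< exists b e d, [/\ (2 ^ i <= b < 2 ^ i.+1)%N, D e, (e * d %| n)%N,
                       dyadic Y (d * b) & (n * b <= X)%N] >].

(** The ratio 32 makes the Chebyshev bounds apart: [psi (2 ^ j)] is at least [2 ^ j / 4], and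
    [psi (2 ^ j / 32)] at most [2 ^ j / 8]. *)
Lemma mangoldt_mass j : (0 < j)%N ->
  1/8 <= \sum_(1 <= r < (2 ^ j).+1 | (2 ^ j < 32 * r)%N) mangoldt r / r%:R :> R.
Proof.
move=> j0; have P0 : 0 < (2 ^ j)%:R :> R by rewrite ltr0n expn_gt0.
have lo : (2 ^ j)%:R / 4 <= psi (2 ^ j) :> R.
  case: j j0 {P0} => // j _; rewrite expnS; apply: le_trans (psi_double_lower _).
  have := @ln2_ge; have : 0 <= (2 ^ j)%:R :> R by [].
  by rewrite natrM; move: ((2 ^ j)%:R : R) => P; nra.
have up : psi (2 ^ j %/ 32) <= (2 ^ j)%:R / 8 :> R.
  apply: le_trans (psi_le _) _; have := @natr_divn_le (2 ^ j) 32; lra.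
apply: (@le_trans _ _ ((psi (2 ^ j) - psi (2 ^ j %/ 32)) / (2 ^ j)%:R)).
  by rewrite ler_pdivlMr //; lra.
rewrite ler_pdivrMr // lerBlDl /psi.
rewrite (bigID (fun r => (2 ^ j < 32 * r)%N)) /= addrC; apply: lerD.
  rewrite [leRHS](big_nat_widen _ _ (2 ^ j).+1) ?ltnS ?leq_div //.
  rewrite (@eq_bigl _ _ _ _ _ _ (fun r => (r < (2 ^ j %/ 32).+1)%N)) // => r.
  by rewrite -leqNgt ltnS leq_divRL // mulnC.
rewrite mulr_suml [leLHS]big_nat_cond [leRHS]big_nat_cond.
apply: ler_sum => r /andP[/andP[r0 rj] _].
rewrite -mulrA ler_peMr ?mangoldt_ge0 // mulrC ler_pdivlMr ?ltr0n // mul1r ler_nat.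
by rewrite -ltnS.
Qed.

Lemma count_scales a r I : (0 < r)%N ->
  (\sum_(0 <= i < I) (r <= 2 ^ (i + a) < 32 * r) <= 5)%N.
Proof.
move=> r0; set u := up_log 2 r.
rewrite -big_mkcond sum1_count -size_filter.
apply: (@leq_trans (size (index_iota (u - a) (u + 5 - a)))); last first.
  by rewrite size_iota; lia.
apply: uniq_leq_size => [|i]; first by rewrite filter_uniq // iota_uniq.
rewrite mem_filter mem_index_iota => /andP[/andP[h1 h2] _].
have h3 : (u <= i + a)%N by apply: up_log_min.
have : (2 ^ (i + a) < 2 ^ (u + 5))%N.
  apply: leq_trans h2 _; rewrite expnD mulnC leq_mul2r /=.
  exact: up_logP.
by rewrite ltn_exp2l // => h4; rewrite mem_index_iota; lia.
Qed.

Lemma sum_dilate S Z X c : (0 < c)%N ->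
  \sum_(1 <= n < X.+1 | S (n * c)%N && (n * c <= Z)%N) (n * c)%:R^-1
  <= \sum_(1 <= n < Z.+1 | (c %| n)%N && S n) n%:R^-1 :> R.
Proof.
move=> c0; rewrite [leRHS]big_mkcondr /= sum_multiples // -big_mkcond.
have E : \sum_(1 <= n < X.+1 | S (n * c)%N && (n * c <= Z)%N) (n * c)%:R^-1
   <= \sum_(1 <= n < (maxn X Z).+1 | S (n * c)%N && (n * c <= Z)%N) (n * c)%:R^-1 :> R.
  by apply: sum_nat_subset => [|//|n *|//]; rewrite ?leq_maxl ?invr_ge0.
apply: le_trans E _.
rewrite [leRHS](big_nat_widen _ _ (maxn X Z).+1); last first.
  by rewrite ltnS; apply: leq_trans (leq_div _ _) _; rewrite leq_maxr.
rewrite [leLHS](@eq_bigl _ _ _ _ _ _ (fun n => S (n * c)%N && (n < (Z %/ c).+1)%N)).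
  exact: lexx.
by move=> n; rewrite ltnS leq_divRL.
Qed.

(** Since [r <= 2 ^ a b], the coordinate [d r] does not exceed [Y]; doubling it as long as it stays
    below [Y] makes it dyadic. Fewer than 8 doublings occur because
    [Y < 8 d 2 ^ (i + a) < 256 d r]. *)
Lemma hit_multiples (D : nat -> Prop) Y Y' a X i n r :
  (0 < n)%N -> (Y' * 2 ^ a <= Y < Y' * 2 ^ a.+1)%N -> hit D Y' X i n ->
  (r <= 2 ^ (i + a) < 32 * r)%N ->
  exists s, [/\ (s < 8)%N, multiples D Y (n * (r * 2 ^ s))%N
    & (n * (r * 2 ^ s) <= 2 ^ (a + 2) * X)%N].
Proof.
move=> n0 /andP[Y1 Y2] /asboolP[b [e [d [/andP[b1 b2] De ed /andP[db1 db2] nb]]]] /andP[r1 r2].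
have r0 : (0 < r)%N by case: r r1 r2.
have d0 : (0 < d)%N by case: d db1 db2 {ed} => //; rewrite !mul0n muln0.
have dr0 : (0 < d * r)%N by rewrite muln_gt0 d0.
have drY : (d * r <= Y)%N.
  apply: leq_trans Y1; apply: leq_trans (leq_mul db1 (leqnn _)).
  rewrite -mulnA leq_mul2l; apply/orP; right; apply: leq_trans r1 _.
  by rewrite expnD leq_mul2r b1 orbT.
set q := (Y %/ (d * r))%N; have q0 : (0 < q)%N by rewrite divn_gt0.
pose s := trunc_log 2 q.
have [s1 s2] := andP (trunc_log_bounds (isT : (1 < 2)%N) q0).
rewrite -/s expnS in s1 s2.
have h1 : (d * (r * 2 ^ s) <= Y)%N.
  by rewrite mulnA; apply: leq_trans (leq_divM Y (d * r)); rewrite mulnC leq_mul2r s1 orbT.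
have h2 : (Y < 2 * (d * (r * 2 ^ s)))%N.
  rewrite (_ : 2 * (d * (r * 2 ^ s)) = 2 * 2 ^ s * (d * r))%N; last by ring.
  by rewrite -ltn_divLR.
exists s; split.
- rewrite -(ltn_exp2l _ _ (isT : (1 < 2)%N)).
  apply: leq_ltn_trans s1 _; rewrite ltn_divLR //; apply: leq_trans Y2 _.
  apply: leq_trans (_ : (2 * (d * b)) * 2 ^ a.+1 <= _)%N.
    by rewrite leq_mul2r ltnW ?orbT.
  rewrite (_ : 2 ^ 8 = 256)%N // (expnS 2 a).
  move: r2 b2; rewrite expnD expnS; move: (2 ^ i)%N (2 ^ a)%N => A B r2 b2.
  rewrite (_ : 2 * (d * b) * (2 * B) = d * (4 * (b * B)))%N; last by ring.
  rewrite (mulnCA 256) leq_mul2l; apply/orP; right.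
  have : (b * B <= 2 * A * B)%N by rewrite leq_mul2r ltnW ?orbT.
  by lia.
- apply/asboolP; exists e, (d * (r * 2 ^ s))%N; split; rewrite /dyadic ?h1 ?h2 //.
  by rewrite mulnA dvdn_mul.
- have db0 : (0 < d * b)%N by case: (d * b)%N db1 db2 => //; rewrite muln0 ltn0.
  rewrite -(leq_pmul2r db0).
  rewrite (_ : n * (r * 2 ^ s) * (d * b) = (n * b) * (d * (r * 2 ^ s)))%N; last by ring.
  apply: leq_trans (leq_mul nb h1) _.
  apply: (@leq_trans (X * (2 * (d * b) * 2 ^ a.+1))%N); last first.
    by rewrite expnS expnD; apply: eq_leq; ring.
  by rewrite leq_mul2l (leq_trans (ltnW Y2)) ?orbT // leq_mul2r ltnW ?orbT.
Qed.

(* The prime powers [r] with [2 ^ (i + a) / 32 < r <= 2 ^ (i + a)] carry a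
   positive proportion of the mass, and each of them, times a bounded power of
   two, can take the place of the [b] that witnesses [hit]. *)
Lemma transfer (D : nat -> Prop) Y Y' a X I U :
  (Y' * 2 ^ a <= Y < Y' * 2 ^ a.+1)%N ->
  \sum_(1 <= n < X.+1) n%:R^-1 *
    (\sum_(0 <= i < I | (0 < i + a)%N && (2 ^ (i + a) <= U)%N) (hit D Y' X i n)%:R)
  <= 10200 * \sum_(1 <= n < (2 ^ (a + 2) * X).+1 | multiples D Y n)
               smoothln U n / n%:R :> R.
Proof.
move=> hY; set Z := (2 ^ (a + 2) * X)%N; set S := multiples D Y.
pose good n r s := S (n * (r * 2 ^ s))%N && (n * (r * 2 ^ s) <= Z)%N.
(* [40 = 8 * 5]: the mass at one scale is at least 1/8, and a given [r] serves at most 5 scales. *)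
have step n : (0 < n)%N ->
    \sum_(0 <= i < I | (0 < i + a)%N && (2 ^ (i + a) <= U)%N) (hit D Y' X i n)%:R
    <= 40 * \sum_(1 <= r < U.+1) \sum_(0 <= s < 8) mangoldt r / r%:R * (good n r s)%:R :> R.
  move=> n0.
  pose w r : R := mangoldt r / r%:R * \sum_(0 <= s < 8) (good n r s)%:R.
  have w0 r : 0 <= w r by rewrite mulr_ge0 ?divr_ge0 ?mangoldt_ge0 ?sumr_ge0.
  apply: (@le_trans _ _ (\sum_(0 <= i < I) 8 *
     \sum_(1 <= r < U.+1) w r * (r <= 2 ^ (i + a) < 32 * r)%N%:R)).
    rewrite big_mkcond; apply: ler_sum => i _; case: ifP => [/andP[ia iU]|_]; last first.
      by rewrite mulr_ge0 // sumr_ge0 // => r _; rewrite mulr_ge0.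
    case: (boolP (hit D Y' X i n)) => hn; last first.
      by rewrite mulr_ge0 // sumr_ge0 // => r _; rewrite mulr_ge0.
    have := mangoldt_mass ia => h.
    apply: (@le_trans _ _ (8 * \sum_(1 <= r < (2 ^ (i + a)).+1 | (2 ^ (i + a) < 32 * r)%N) mangoldt r / r%:R)).
      by rewrite /= mulr1n; lra.
    rewrite ler_wpM2l //; apply: sum_nat_subset => // [r * |r r0 rU rs]; first by rewrite mulr_ge0.
    rewrite rU rs mulr1 /w ler_peMr ?divr_ge0 ?mangoldt_ge0 //.
    have [s [s8 s1 s2]] : exists s, [/\ (s < 8)%N, S (n * (r * 2 ^ s))%N & (n * (r * 2 ^ s) <= Z)%N].
      by apply: (hit_multiples n0 hY hn); rewrite rU rs.
    rewrite big_mkord (bigD1 (Ordinal s8)) //= /good s1 s2 ler_wpDr //.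
    by apply: sumr_ge0.
  rewrite -mulr_sumr exchange_big /= (_ : 40 = 8 * 5); last by lra.
  rewrite -mulrA ler_wpM2l // mulr_sumr; apply: ler_sum_nat => r /andP[r0 _].
  rewrite -!mulr_sumr -/(w r) mulrC ler_wpM2r // -natr_sum ler_nat.
  exact: count_scales.
apply: (@le_trans _ _ (\sum_(1 <= n < X.+1) n%:R^-1 * (40 * \sum_(1 <= r < U.+1) \sum_(0 <= s < 8) mangoldt r / r%:R * (good n r s)%:R))).
  by apply: ler_sum_nat => n /andP[n0 _]; rewrite ler_wpM2l ?invr_ge0 // step.
under eq_bigr => n _ do rewrite mulrCA mulr_sumr.
rewrite -mulr_sumr exchange_big /=.
(* The substitution of [n] for [n r 2 ^ s] costs a factor [2 ^ s], and these add up to 255 over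
   [s < 8]. *)
apply: (@le_trans _ _ (40 * \sum_(1 <= r < U.+1) mangoldt r * (255 * \sum_(1 <= n < Z.+1 | (r %| n)%N && S n) n%:R^-1))).
  rewrite ler_wpM2l //; apply: ler_sum_nat => r /andP[r0 _].
  under eq_bigr => n _ do rewrite mulr_sumr.
  rewrite exchange_big /=.
  apply: (@le_trans _ _ (\sum_(0 <= s < 8) mangoldt r * ((2 ^ s)%:R * \sum_(1 <= n < Z.+1 | (r %| n)%N && S n) n%:R^-1))).
    apply: ler_sum => s _.
    have c0 : (0 < r * 2 ^ s)%N by rewrite muln_gt0 r0 expn_gt0.
    apply: (@le_trans _ _ (mangoldt r * ((2 ^ s)%:R * \sum_(1 <= n < X.+1 | good n r s) (n * (r * 2 ^ s))%:R^-1))).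
      rewrite !mulr_sumr [leRHS]big_mkcond; apply: ler_sum_nat => n /andP[n0 _].
      case: ifP => hg; last by rewrite !mulr0.
      rewrite mulr1 !natrM; have : r%:R != 0 :> R by rewrite pnatr_eq0; lia.
      have : n%:R != 0 :> R by rewrite pnatr_eq0; lia.
      have : (2 ^ s)%:R != 0 :> R by rewrite pnatr_eq0 -lt0n expn_gt0.
      move=> h1 h2 h3; rewrite le_eqVlt; apply/orP; left; apply/eqP; field; rewrite h1 h2 h3 //.
    rewrite ler_wpM2l ?mangoldt_ge0 // ler_wpM2l //.
    apply: le_trans (sum_dilate _ _ _ c0) _.
    apply: sum_nat_subset => // [n _ _ /andP[h ->]|n *]; last by rewrite invr_ge0.
    by rewrite andbT (dvdn_trans _ h) // dvdn_mulr.
  rewrite -mulr_sumr ler_wpM2l ?mangoldt_ge0 // -mulr_suml -natr_sum.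
  rewrite (_ : (\sum_(0 <= s < 8) 2 ^ s)%N = 255%N) //.
  by rewrite !big_nat_recr //= big_geq.
rewrite (_ : 10200 = 40 * 255); last by lra.
rewrite -[leRHS]mulrA ler_wpM2l //.
rewrite [leLHS](eq_bigr _ (fun r _ => mulrCA _ _ _)) -mulr_sumr ler_wpM2l //.
rewrite [leLHS](eq_bigr _ (fun r _ => mulr_sumr _ _ _ _)).
rewrite (exchange_big_dep S) /=; last by move=> r n _ /andP[].
apply: ler_sum => n Sn; rewrite /smoothln mulr_suml le_eqVlt; apply/orP; left.
by apply/eqP/eq_bigl => r; rewrite Sn andbT.
Qed.

(** * Second moments over one coordinate *)

Definition fits (D : nat -> Prop) Y n b : bool :=
  `[< exists e d, [/\ D e, (e * d %| n)%N & dyadic Y (d * b)] >].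

Lemma fits_hit (D : nat -> Prop) Y X n b : (0 < b)%N -> (n * b <= X)%N ->
  fits D Y n b -> hit D Y X (trunc_log 2 b) n.
Proof.
move=> b0 nb /asboolP[e [d [De edn db]]]; apply/asboolP; exists b, e, d; split => //.
exact: trunc_log_bounds.
Qed.

Lemma mangoldt1 : mangoldt 1 = 0 :> R.
Proof. by have := @psi1; rewrite /psi big_nat1. Qed.

(** Confining [b * c] to one dyadic interval leaves, for each [b], a mass of at most [8 / b] to [c];
    so only one logarithm is lost, not two. *)
Lemma pair_mass T i : (1 < T)%N ->
  \sum_(1 <= b < T.+1) \sum_(1 <= c < T.+1 | (2 ^ i <= b * c < 2 ^ i.+1)%N)
    mangoldt b * mangoldt c / (b * c)%:R <= 72 * ln T%:R :> R.
Proof.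
move=> T1; apply: (@le_trans _ _ (8 * \sum_(1 <= b < T.+1) mangoldt b / b%:R)); last first.
  by have := @sum_mangoldt_div _ T1; lra.
rewrite mulr_sumr; apply: ler_sum_nat => b /andP[b0 _].
have P0 : 0 < (2 ^ i)%:R :> R by rewrite ltr0n expn_gt0.
apply: (@le_trans _ _ (mangoldt b * (psi (2 ^ i.+1 %/ b) / (2 ^ i)%:R))); last first.
  rewrite (mulrCA 8) ler_wpM2l ?mangoldt_ge0 // ler_pdivrMr //.
  apply: le_trans (psi_le _) _; have := @natr_divn_le (2 ^ i.+1) b.
  by rewrite expnS natrM; lra.
rewrite /psi [X in _ <= _ * X]mulr_suml [leRHS]mulr_sumr.
have E : \sum_(1 <= c < T.+1 | (2 ^ i <= b * c < 2 ^ i.+1)%N) mangoldt b * mangoldt c / (b * c)%:R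
   <= \sum_(1 <= c < (maxn T (2 ^ i.+1)).+1 | (c <= 2 ^ i.+1 %/ b)%N) mangoldt b * (mangoldt c / (2 ^ i)%:R) :> R.
  apply: sum_nat_subset; first by rewrite leq_maxl.
  - by move=> c c0 _ /andP[_ h]; rewrite leq_divRL // mulnC ltnW.
  - by move=> c c0 _ _; rewrite !mulr_ge0 ?invr_ge0 ?mangoldt_ge0.
  - move=> c c0 _ /andP[h _]; rewrite -mulrA ler_wpM2l ?mangoldt_ge0 // ler_wpM2l ?mangoldt_ge0 //.
    by rewrite lef_pV2 ?posrE ?ltr0n ?muln_gt0 ?b0 ?expn_gt0 // ler_nat.
apply: le_trans E _; rewrite [leRHS](big_nat_widen _ _ (maxn T (2 ^ i.+1)).+1) //.
by rewrite ltnS (leq_trans (leq_div _ _)) // leq_maxr.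
Qed.

(** The weighted number of pairs of prime powers that can be deleted together from one coordinate: a
    stand-in for the square of [smoothln T d]. *)
Definition pair_sum (D : nat -> Prop) Y T n : R :=
  \sum_(1 <= b < T.+1) \sum_(1 <= c < T.+1 |
    (b * c %| n)%N && fits D Y (n %/ (b * c)) (b * c)) mangoldt b * mangoldt c.

Lemma pair_sum_ge0 D Y T n : 0 <= pair_sum D Y T n.
Proof.
by apply: sumr_ge0 => b _; apply: sumr_ge0 => c _; rewrite mulr_ge0 ?mangoldt_ge0.
Qed.

(** Deleting [b <= T] from [d] lowers [smoothln T] by at most [ln T], by subadditivity; the second
    factor counts the choices of [c] that remain. *)
Lemma pair_sum_ge (D : nat -> Prop) Y T n e d : (0 < T)%N -> (0 < n)%N ->
  D e -> dyadic Y d -> (e * d %| n)%N ->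
  smoothln T d * (smoothln T d - ln T%:R) <= pair_sum D Y T n.
Proof.
move=> T0 n0 De Yd /dvdnP[q nE].
have d0 : (0 < d)%N by case: d Yd nE n0 => // _ ->; rewrite !muln0.
rewrite {1}/smoothln mulr_suml.
apply: (@le_trans _ _ (\sum_(1 <= b < T.+1 | (b %| d)%N) mangoldt b * smoothln T (d %/ b)%N)).
  rewrite [leLHS]big_nat_cond [leRHS]big_nat_cond.
  apply: ler_sum => b /andP[/andP[b0 bT] /dvdnP[r dE]].
  have r0 : (0 < r)%N by case: r dE d0 => // ->; rewrite mul0n.
  rewrite ler_wpM2l ?mangoldt_ge0 // dE mulnK // lerBlDr.
  apply: le_trans (smoothlnM T r0 b0) _; rewrite lerD2l.
  by apply: le_trans (smoothln_le_ln T b0) _; apply: ler_ln_nat.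
apply: sum_nat_subset => // [b b0 bT _|b b0 bT /dvdnP[r dE]].
  by apply: sumr_ge0 => c _; rewrite mulr_ge0 ?mangoldt_ge0.
rewrite dE mulnK // /smoothln mulr_sumr.
apply: sum_nat_subset => // [c c0 cT /dvdnP[t rE]|c c0 *]; last by rewrite mulr_ge0 ?mangoldt_ge0.
have E : (n = q * e * t * (b * c))%N by rewrite nE dE rE; ring.
rewrite E dvdn_mull // mulnK ?muln_gt0 ?b0 //=; apply/asboolP.
exists e, t; split => //; first by rewrite -mulnA dvdn_mull.
by rewrite (_ : (t * (b * c) = d)%N) // dE rE; ring.
Qed.

(** Put [n = m b c]: then [m] is hit at the scale of [b * c], and each scale carries weight at most
    [72 ln T]. [transfer] with [a = 0] replaces the pair by a single prime power up to [T ^ 2]. *)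
Lemma sum_pair_sum (D : nat -> Prop) Y T X : (1 < T)%N -> (0 < Y)%N ->
  \sum_(1 <= n < X.+1) pair_sum D Y T n / n%:R
  <= 72 * ln T%:R * (10200 * \sum_(1 <= n < (4 * X).+1 | multiples D Y n)
               smoothln (T ^ 2) n / n%:R).
Proof.
move=> T1 Y0.
have T0 : 0 <= ln T%:R :> R by apply: ln_nat_ge0.
have hY : (Y * 2 ^ 0 <= Y < Y * 2 ^ 1)%N by rewrite expn0 expn1; lia.
have := @transfer D Y Y 0 X (T ^ 2).+1 (T ^ 2) hY; rewrite (_ : (2 ^ (0 + 2) = 4)%N) //.
move=> tr; apply: le_trans (ler_wpM2l _ tr); last by rewrite mulr_ge0.
pose term b c : R := mangoldt b * mangoldt c / (b * c)%:R.
have term0 b c : 0 <= term b c by rewrite divr_ge0 ?mulr_ge0 ?mangoldt_ge0.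
have -> : \sum_(1 <= n < X.+1) pair_sum D Y T n / n%:R =
    \sum_(1 <= b < T.+1) \sum_(1 <= c < T.+1)
      \sum_(1 <= m < (X %/ (b * c)).+1) (fits D Y m (b * c))%:R * (term b c / m%:R) :> R.
  rewrite /pair_sum; under eq_bigr => n _ do rewrite mulr_suml.
  rewrite exchange_big /=; apply: eq_big_nat => b /andP[b0 _].
  under eq_bigr => n _ do rewrite mulr_suml big_mkcond.
  rewrite exchange_big /=; apply: eq_big_nat => c /andP[c0 _].
  have bc0 : (0 < b * c)%N by rewrite muln_gt0 b0.
  rewrite [RHS](eq_bigr (fun m => (fits D Y ((m * (b * c)) %/ (b * c)) (b * c))%:R
      * (mangoldt b * mangoldt c / (m * (b * c))%:R))); last first.
    by move=> m _; rewrite mulnK // /term (mulnC m) (natrM _ (b * c) m) invfM !mulrA.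
  rewrite -(sum_multiples X (fun n => (fits D Y (n %/ (b * c)) (b * c))%:R
      * (mangoldt b * mangoldt c / n%:R)) bc0) [RHS]big_mkcond.
  apply: eq_bigr => n _; case: (b * c %| n)%N => //=.
  by case: fits; rewrite ?mul1r ?mul0r.
pose P i := (0 < i + 0)%N && (2 ^ (i + 0) <= T ^ 2)%N.
pose inS i b c : R := (2 ^ i <= b * c < 2 ^ i.+1)%N%:R.
apply: (@le_trans _ _ (\sum_(1 <= b < T.+1) \sum_(1 <= c < T.+1) \sum_(1 <= m < X.+1)
    \sum_(0 <= i < (T ^ 2).+1 | P i) (hit D Y X i m)%:R / m%:R * (inS i b c * term b c))).
  apply: ler_sum_nat => b /andP[b0 bT]; apply: ler_sum_nat => c /andP[c0 cT].
  have bc0 : (0 < b * c)%N by rewrite muln_gt0 b0.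
  have pos m i : 0 <= (hit D Y X i m)%:R / m%:R * (inS i b c * term b c) :> R.
    by rewrite mulr_ge0 ?divr_ge0 // mulr_ge0.
  apply: sum_nat_subset => [|//|m m0 mX _|m m0 mX _]; first exact: leq_div.
    by apply: sumr_ge0.
  case: (boolP (fits D Y m (b * c))) => hf; last by rewrite mul0r sumr_ge0.
  (* [transfer] excludes scale 0 here, where [b = c = 1] has weight 0 anyway. *)
  have [bc1|bc1] := leqP (b * c) 1.
    have b1 : b = 1%N by nia.
    rewrite [leLHS](_ : _ = 0); first by rewrite sumr_ge0.
    by rewrite /term b1 mangoldt1 !mul0r mulr0.
  set i := trunc_log 2 (b * c).
  have mbc : (m * (b * c) <= X)%N by rewrite -leq_divRL.
  have hi : hit D Y X i m by apply: fits_hit.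
  have [i1 i2] := andP (trunc_log_bounds (isT : (1 < 2)%N) bc0).
  have bT2 : (b * c <= T ^ 2)%N by rewrite expnS expn1 leq_mul.
  have iT : (i < (T ^ 2).+1)%N.
    by rewrite ltnS (leq_trans _ bT2) // (leq_trans _ i1) // ltnW // ltn_expl.
  have Pi : P i.
    rewrite /P addn0 (leq_trans i1 bT2) andbT lt0n; apply/eqP => i0.
    by move: i2; rewrite -/i i0 expn1 ltnNge bc1.
  rewrite big_mkord (bigD1 (Ordinal iT)) //= hi /inS i1 i2 /= ler_wpDr //.
    by apply: sumr_ge0 => j _; apply: pos.
  by rewrite !mul1r mulrC.
rewrite [leLHS](eq_bigr _ (fun b _ => exchange_big _ _ _ _ _ _)) /= exchange_big /= mulr_sumr.
apply: ler_sum_nat => m /andP[m0 mX].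
rewrite mulrCA !mulr_sumr.
rewrite [leLHS](eq_bigr _ (fun b _ => exchange_big _ _ _ _ _ _)) /= exchange_big /=.
apply: ler_sum => i Pi.
have E : \sum_(1 <= b < T.+1) \sum_(1 <= c < T.+1) inS i b c * term b c <= 72 * ln T%:R.
  apply: le_trans (pair_mass i T1); apply: ler_sum => b _.
  rewrite [leRHS]big_mkcond; apply: ler_sum => c _; rewrite /inS.
  by case: ifP => _; rewrite ?mul1r ?mul0r.
rewrite (eq_bigr (fun b => (hit D Y X i m)%:R / m%:R * \sum_(1 <= c < T.+1) inS i b c * term b c)); last first.
  by move=> b _; rewrite mulr_sumr.
rewrite -mulr_sumr; apply: (@le_trans _ _ ((hit D Y X i m)%:R / m%:R * (72 * ln T%:R))).
  by rewrite ler_wpM2l // divr_ge0.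
by rewrite le_eqVlt; apply/orP; left; apply/eqP; ring.
Qed.

(** * Enlarging one coordinate *)

Lemma dyadic_mass i :
  \sum_(2 ^ i <= b < 2 ^ i.+1) ((b == 1)%:R + mangoldt b) / b%:R <= 9 :> R.
Proof.
have P0 : 0 < (2 ^ i)%:R :> R by rewrite ltr0n expn_gt0.
apply: (@le_trans _ _ ((1 + psi (2 ^ i.+1)) / (2 ^ i)%:R)); last first.
  rewrite ler_pdivrMr //; have := @psi_le (2 ^ i.+1); rewrite expnS natrM => h.
  have : 1 <= (2 ^ i)%:R :> R by rewrite ler1n expn_gt0.
  lra.
rewrite ler_pdivlMr // mulr_suml.
apply: (@le_trans _ _ (\sum_(2 ^ i <= b < 2 ^ i.+1) ((b == 1)%:R + mangoldt b))).
  apply: ler_sum_nat => b /andP[h _]; have b0 : (0 < b)%N by rewrite (leq_trans _ h) // expn_gt0.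
  rewrite -mulrA ler_piMr ?addr_ge0 ?mangoldt_ge0 // mulrC ler_pdivrMr ?ltr0n //.
  by rewrite mul1r ler_nat.
have h : (2 ^ i <= (2 ^ i.+1).+1)%N by rewrite leqW // leq_exp2l.
apply: (@le_trans _ _ (\sum_(1 <= b < (2 ^ i.+1).+1) ((b == 1)%:R + mangoldt b))).
  rewrite [leRHS](big_cat_nat (n := (2 ^ i)%N)) //= ?expn_gt0 // ler_wpDl //.
    by apply: sumr_ge0 => b _; rewrite addr_ge0 ?mangoldt_ge0.
  rewrite big_nat_recr /= ?leq_exp2l // ler_wpDr // addr_ge0 ?mangoldt_ge0 //.
rewrite big_split /= lerD2r big_ltn ?ltnS ?expn_gt0 //=.
rewrite big_nat_cond big1 ?addr0 // => b /andP[/andP[b1 _] _].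
by case: eqP b1 => // ->.
Qed.

(* Replacing a prime power [b] of the coordinate [d] by one about [2 ^ a] times larger. *)
Lemma shift_coordinate (D : nat -> Prop) Y Y' a X (C : R) :
  (0 < a)%N -> (0 < Y')%N -> (Y' * 2 ^ a <= Y < Y' * 2 ^ a.+1)%N ->
  \sum_(1 <= n < (2 ^ (a + 2) * X).+1 | multiples D Y n) smoothln Y n / n%:R
    <= C * ln Y%:R * recsum (multiples D Y) (2 ^ (a + 2) * X) ->
  recsum (multiples D Y') X
    <= 9 * 10200 * C * a.+2%:R * recsum (multiples D Y) (2 ^ (a + 2) * X).
Proof.
move=> a0 Y'0 hY hC; have [hY1 hY2] := andP hY.
have Y1 : (1 < Y)%N.
  apply: leq_trans hY1; apply: (@leq_trans (1 * 2 ^ 1)%N) => //.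
  by rewrite leq_mul // leq_exp2l.
have lY : 0 < ln Y%:R :> R by have := @ln_nat_ge_half _ Y1; lra.
have a20 : 0 < a.+2%:R :> R by [].
set S := multiples D Y in hC *; set Z := (2 ^ (a + 2) * X)%N in hC *.
(* The unit at [b = 1] makes the divisors of [d] weigh [1 + ln d] in total, which is positive even
   for [d = 1]. *)
pose L1 b : R := (b == 1)%:R + mangoldt b.
have L10 b : 0 <= L1 b by rewrite addr_ge0 ?mangoldt_ge0.
have main : ln Y%:R / a.+2%:R * recsum (multiples D Y') X <=
    9 * (10200 * \sum_(1 <= n < Z.+1 | S n) smoothln Y n / n%:R) :> R.
  apply: (@le_trans _ _ (\sum_(1 <= n < X.+1) \sum_(1 <= b < X.+1 | (b %| n)%N)
      (fits D Y' (n %/ b) b)%:R * L1 b / (b%:R * (n %/ b)%:R))).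
    rewrite mulr_sumr [leLHS]big_mkcond; apply: ler_sum_nat => n /andP[n0 nX].
    case: ifP => [/asboolP[e [d [De Yd /dvdnP[q nE]]]]|_]; last first.
      by apply: sumr_ge0 => b _; rewrite divr_ge0 ?mulr_ge0.
    have [d1 d2] := andP Yd.
    have d0 : (0 < d)%N by case: d d2 {Yd d1 nE}; rewrite ?muln0.
    have dn : (d %| n)%N by rewrite nE mulnA dvdn_mull.
    apply: (@le_trans _ _ (\sum_(1 <= b < X.+1 | (b %| d)%N) L1 b / n%:R)); last first.
      apply: sum_nat_subset => // [b _ _ /dvdn_trans/(_ dn)//|b *|b b0 bX /dvdnP[r dE]].
        by rewrite divr_ge0 ?mulr_ge0.
      have E : n = (q * e * r * b)%N by rewrite nE dE; ring.
      have -> : fits D Y' (n %/ b) b.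
        apply/asboolP; exists e, r; split; rewrite -?dE //.
        by rewrite E mulnK // -mulnA dvdn_mull.
      by rewrite mul1r -natrM E mulnK // (mulnC b).
    rewrite -mulr_suml ler_wpM2r ?invr_ge0 // big_split /=.
    have -> : \sum_(1 <= b < X.+1 | (b %| d)%N) mangoldt b = ln d%:R :> R.
      by apply: smoothln_ge => //; apply: leq_trans (dvdn_leq n0 dn) _.
    have h1 : 1 <= \sum_(1 <= b < X.+1 | (b %| d)%N) (b == 1)%:R :> R.
      have X0 : (0 < X)%N by apply: leq_trans n0 nX.
      by rewrite big_ltn_cond // dvd1n /= ler_wpDr // sumr_ge0.
    (* From [Y < 2 ^ a.+1 Y'] and [Y' < 2 d]. *)
    have h2 : ln Y%:R <= a.+2%:R * (1 + ln d%:R) :> R.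
      have : (Y <= 2 ^ a.+2 * d)%N.
        apply: leq_trans (ltnW hY2) _; rewrite (expnS 2 a.+1).
        rewrite (_ : 2 * 2 ^ a.+1 * d = 2 * d * 2 ^ a.+1)%N; last by ring.
        by rewrite leq_mul2r (ltnW d2) orbT.
      move=> /(@ler_ln_nat _ _ (ltnW Y1)) /le_trans; apply.
      rewrite ln_natM ?expn_gt0 // ln_natX // -(mulr_natl (ln 2)) mulrDr mulr1.
      apply: lerD; first by rewrite ler_piMr // ln2_le.
      by rewrite ler_peMl ?ln_nat_ge0 // ler1n.
    by rewrite ler_pdivrMr // mulrC; apply: le_trans h2 _; rewrite ler_wpM2l // lerD2r.
  rewrite (sum_divisors X (fun m b => (fits D Y' m b)%:R * L1 b / (b%:R * m%:R))).
  apply: le_trans (ler_wpM2l _ (@transfer D Y Y' a X X.+1 Y hY)) => //.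
  rewrite mulr_sumr; apply: ler_sum_nat => m /andP[m0 mX].
  rewrite mulrCA.
  have -> : \sum_(1 <= b < (X %/ m).+1) (fits D Y' m b)%:R * L1 b / (b%:R * m%:R)
     = m%:R^-1 * \sum_(1 <= b < (X %/ m).+1) (fits D Y' m b)%:R * (L1 b / b%:R) :> R.
    by rewrite mulr_sumr; apply: eq_bigr => b _; rewrite invfM; ring.
  rewrite ler_wpM2l ?invr_ge0 //.
  pose P i := (0 < i + a)%N && (2 ^ (i + a) <= Y)%N.
  apply: (@le_trans _ _ (\sum_(1 <= b < (X %/ m).+1) \sum_(0 <= i < X.+1 | P i)
     (hit D Y' X i m)%:R * ((2 ^ i <= b < 2 ^ i.+1)%N%:R * (L1 b / b%:R)))).
    apply: ler_sum_nat => b /andP[b0 bX].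
    have pos i : 0 <= (hit D Y' X i m)%:R * ((2 ^ i <= b < 2 ^ i.+1)%N%:R * (L1 b / b%:R)) :> R.
      by rewrite mulr_ge0 // mulr_ge0 // divr_ge0.
    case: (boolP (fits D Y' m b)) => hf; last by rewrite mul0r sumr_ge0.
    set i := trunc_log 2 b.
    have mb : (m * b <= X)%N by rewrite mulnC -leq_divRL.
    have hi : hit D Y' X i m by apply: fits_hit.
    have [i1 i2] := andP (trunc_log_bounds (isT : (1 < 2)%N) b0).
    have bY : (b <= Y')%N.
      move: hf => /asboolP[e [d [_ _ /andP[h1 h2]]]]; apply: leq_trans h1.
      by rewrite leq_pmull //; case: d h2; rewrite ?mul0n ?muln0.
    have iX : (i < X.+1)%N.
      rewrite ltnS (leq_trans _ mb) // (leq_trans _ (leq_pmull _ m0)) // (leq_trans _ i1) //.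
      by rewrite ltnW // ltn_expl.
    (* [b <= Y'] gives [2 ^ (i + a) <= 2 ^ a Y' <= Y], so prime powers up to [Y] suffice; scale
       [i = 0] is allowed because [a > 0]. *)
    have Pi : P i.
      rewrite /P addn_gt0 a0 orbT /= (leq_trans _ hY1) // expnD leq_mul2r.
      by rewrite (leq_trans i1 bY) orbT.
    rewrite big_mkord (bigD1 (Ordinal iX)) //= hi i1 i2 /= ler_wpDr // ?mul1r //.
    by apply: sumr_ge0 => j _; apply: pos.
  rewrite exchange_big /= mulr_sumr; apply: ler_sum => i Pi.
  rewrite -mulr_sumr mulrC ler_wpM2r //; apply: le_trans (dyadic_mass i).
  rewrite [leRHS](_ : _ = \sum_(1 <= b < (2 ^ i.+1 + X).+1 | (2 ^ i <= b < 2 ^ i.+1)%N) L1 b / b%:R).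
    apply: (@le_trans _ _ (\sum_(1 <= b < (X %/ m).+1 | (2 ^ i <= b < 2 ^ i.+1)%N) L1 b / b%:R)).
      by rewrite [leRHS]big_mkcond; apply: ler_sum => b _; case: ifP => _; rewrite ?mul1r ?mul0r.
    apply: sum_nat_subset => [|//|b *|//]; last by rewrite divr_ge0.
    by rewrite (leq_trans (leq_div _ _)) // leq_addl.
  rewrite (big_nat_widenl _ 1) ?expn_gt0 // (big_nat_widen _ _ (2 ^ i.+1 + X).+1).
    by apply: eq_bigl.
  by rewrite leqW // leq_addr.
have h : ln Y%:R / a.+2%:R * recsum (multiples D Y') X <=
    ln Y%:R / a.+2%:R * (9 * 10200 * C * a.+2%:R * recsum S Z) :> R.
  apply: le_trans main _.
  apply: (@le_trans _ _ (9 * 10200 * (C * ln Y%:R * recsum S Z))).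
    by rewrite -[leRHS]mulrA ler_wpM2l // ler_wpM2l.
  rewrite le_eqVlt; apply/orP; left; apply/eqP; move: (a.+2%:R : R) a20 => A A0.
  by field; rewrite gt_eqF.
by move: h; rewrite ler_pM2l // divr_gt0.
Qed.

End Transfer.

(** * Several coordinates *)

Section Boxes.
Implicit Types (m n T X Q M : nat) (S : pred nat).

Definition boxed k (Y : 'I_k -> nat) : pred nat := fun n =>
  `[< exists d : 'I_k -> nat, (forall i, dyadic (Y i) (d i)) /\ (\prod_i d i %| n)%N >].

Definition others k (Y : 'I_k -> nat) (j : 'I_k) : nat -> Prop := fun e =>
  exists d : 'I_k -> nat, (forall i, i != j -> dyadic (Y i) (d i)) /\
    e = (\prod_(i | i != j) d i)%N.

(** Brings boxes into the setting with one distinguished coordinate. *)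
Lemma boxedE k (Y : 'I_k -> nat) j : boxed Y =1 multiples (others Y j) (Y j).
Proof.
move=> n; apply/asboolP/asboolP => [[d [dY dn]]|[e [dj [[d [dY ->]] djY dn]]]].
  exists (\prod_(i | i != j) d i)%N, (d j); split => //; first by exists d.
  by move: dn; rewrite (bigD1 j) //= mulnC.
exists (fun i => if i == j then dj else d i); split.
  by move=> i; case: eqP => [->//|/eqP]; apply: dY.
rewrite (bigD1 j) //= eqxx mulnC (eq_bigr d) // => i /negbTE ->.
by [].
Qed.

Lemma boxed_closed k (Y : 'I_k -> nat) : mult_closed (boxed Y).
Proof.
move=> n m _ _ /asboolP[d [dY dn]]; apply/asboolP; exists d; split => //.
exact: dvdn_mulr.
Qed.

Lemma boxed_generated k (Y : 'I_k -> nat) : generated_below (boxed Y) (\prod_i Y i).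
Proof.
move=> n n0 /asboolP[d [dY dn]]; exists (\prod_i d i)%N; split => //.
  by apply/asboolP; exists d.
by apply: leq_prod => i _; have /andP[] := dY i.
Qed.

(** * The average of the smooth part over a box *)

Lemma smoothln_prod T k (d : 'I_k -> nat) : (forall i, 0 < d i)%N ->
  smoothln T (\prod_i d i)%N <= \sum_i smoothln T (d i) :> R.
Proof.
move=> d0; pose K (s : R) m := (0 < m)%N /\ smoothln T m <= s.
suff [] : K (\sum_i smoothln T (d i)) (\prod_i d i)%N by [].
apply: big_rec2 => [|i m s _ [m0 h]].
  by split=> //; apply: le_trans (smoothln_le_ln T _) _ => //; rewrite ln1.
split; first by rewrite muln_gt0 d0.
by apply: le_trans (smoothlnM T (d0 i) m0) _; rewrite lerD2l.
Qed.

(** With [n = m b] and [m] in [S], the sum over [b] separates and Mertens' bound applies. *)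
Lemma sum_small_cofactors S X T : (1 < T)%N ->
  \sum_(1 <= n < X.+1)
    (\sum_(1 <= b < T.+1 | (b %| n)%N && S (n %/ b)%N) mangoldt b) / n%:R
  <= 9 * ln T%:R * recsum S X :> R.
Proof.
move=> T1; apply: (@le_trans _ _ (\sum_(1 <= b < T.+1) mangoldt b / b%:R * recsum S X)); last first.
  by rewrite -mulr_suml ler_wpM2r ?recsum_ge0 // sum_mangoldt_div.
under eq_bigr => n _ do rewrite mulr_suml.
rewrite (exchange_big_dep xpredT) //=; apply: ler_sum_nat => b /andP[b0 _].
rewrite big_mkcondr /= sum_multiples // -big_mkcond /recsum mulr_sumr.
apply: sum_nat_subset => [|m m0 _|m *|m m0 _ _]; rewrite ?leq_div //.
- by rewrite mulnK.
- by rewrite mulr_ge0 ?divr_ge0 ?mangoldt_ge0 ?invr_ge0.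
by rewrite natrM invfM -mulrA [X in _ <= _ * X]mulrC.
Qed.

(** The first two factors come from [sum_pair_sum], the 2 from [ln (T ^ 2)], and [17 ^+ 2] from the
    return from [4 X] to [X]. *)
Definition transfer_const : R := 72 * 10200 * 2 * 17 ^+ 2.
(** Large enough for the second moments of all [k] coordinates, divided by the cutoff, to use up at
    most half of [smooth_const]. *)
Definition cutoff_const k : R := 2 * (transfer_const * k%:R) + 1.
(** The solution [C] of [C = k (K + 1) + C / 2 + 9], where [K] is the cutoff constant, so that the
    descent reproduces its own bound. *)
Definition smooth_const k : R := 2 * (k%:R * (cutoff_const k + 1) + 9).

Lemma transfer_const_ge0 : 0 <= transfer_const.
Proof. by rewrite /transfer_const !mulr_ge0 ?exprn_ge0 ?ler0n. Qed.

Lemma cutoff_const_ge1 k : 1 <= cutoff_const k.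
Proof.
rewrite /cutoff_const; have : 0 <= transfer_const * k%:R by rewrite mulr_ge0 ?transfer_const_ge0.
lra.
Qed.

Lemma smooth_const_ge0 k : 0 <= smooth_const k.
Proof.
have := cutoff_const_ge1 k; rewrite /smooth_const => h.
by rewrite mulr_ge0 // addr_ge0 // mulr_ge0 //; lra.
Qed.

(* The part of a coordinate that is larger than the cutoff is controlled by
   its second moment, which in turn is a first moment at the scale [T ^ 2];
   hence the descent from large [T], where the bound is trivial. *)
Lemma smoothln_average k (Y : 'I_k -> nat) T X :
  (forall i, 0 < Y i)%N -> (1 < T)%N -> (\prod_i Y i <= X)%N ->
  \sum_(1 <= n < X.+1 | boxed Y n) smoothln T n / n%:R
  <= smooth_const k * ln T%:R * recsum (boxed Y) X.
Proof.
move=> Y0; set S := boxed Y; set Q := (\prod_i Y i)%N.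
have Sm : mult_closed S by apply: boxed_closed.
have Sg : generated_below S Q by apply: boxed_generated.
pose V U n : R := \sum_(1 <= b < U.+1 | (b %| n)%N && S (n %/ b)%N) mangoldt b.
have split_n U n : (0 < n)%N -> S n -> exists d : 'I_k -> nat,
    [/\ forall i, dyadic (Y i) (d i), (\prod_i d i %| n)%N
      & smoothln U n <= \sum_i smoothln U (d i) + V U n].
  move=> n0 /asboolP[d [dY dn]]; exists d; split => //.
  have d0 i : (0 < d i)%N by have := dY i; case: (d i) => //; rewrite /dyadic muln0 andbF.
  have P0 : (0 < \prod_i d i)%N by apply: prodn_gt0.
  rewrite -{1}(divnK dn) mulnC; apply: le_trans (smoothlnM U P0 _) _.
    by rewrite divn_gt0 // dvdn_leq.
  apply: lerD; first exact: smoothln_prod.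
  by apply: smoothln_cofactor_le => //; apply/asboolP; exists d.
(* [Z] bounds the excess of the [Y i] over [T]. As [T >= 2], passing to [T ^ 2] lowers it by at
   least 1. *)
have [Z] : exists Z, (forall i, Y i <= T + Z)%N.
  exists (\sum_i Y i)%N => i; rewrite (bigD1 i) //=; lia.
elim: Z T X => [|Z IH] T X YZ T1 QX.
  (* Every [Y i] is at most [T], so each coordinate contributes at most [ln T]. *)
  have l0 : 0 <= ln T%:R :> R by apply: ln_nat_ge0.
  have := sum_small_cofactors S X T1 => hV.
  apply: (@le_trans _ _ (\sum_(1 <= n < X.+1 | S n) k%:R * ln T%:R / n%:R + 9 * ln T%:R * recsum S X)).
    apply: le_trans (lerD (lexx _) hV).
    rewrite [leLHS]big_mkcond [X in _ <= X + _]big_mkcond -big_split /=.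
    apply: ler_sum_nat => n /andP[n0 _]; case: ifP => Sn; last first.
      by rewrite add0r divr_ge0 // sumr_ge0 // => b _; apply: mangoldt_ge0.
    rewrite -mulrDl ler_wpM2r ?invr_ge0 //.
    have [d [dY dn h]] := split_n T n n0 Sn; apply: le_trans h _; rewrite lerD2r.
    apply: (@le_trans _ _ (\sum_(i < k) ln T%:R)); last by rewrite sumr_const card_ord mulr_natl.
    apply: ler_sum => i _.
    have d0 : (0 < d i)%N by have := dY i; case: (d i) => //; rewrite /dyadic muln0 andbF.
    apply: le_trans (smoothln_le_ln T d0) _; apply: ler_ln_nat => //.
    by have /andP[h _] := dY i; apply: leq_trans h _; rewrite -(addn0 T).
  rewrite -mulr_sumr -/(recsum S X) -mulrDl ler_wpM2r ?recsum_ge0 // -mulrDl ler_wpM2r //.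
  rewrite /smooth_const; have := cutoff_const_ge1 k; have : 0 <= k%:R :> R by [].
  by move: (k%:R : R) (cutoff_const k) => x y; nra.
have T2 : (1 < T ^ 2)%N by rewrite expnS expn1; nia.
have YZ2 i : (Y i <= T ^ 2 + Z)%N.
  by have := YZ i; rewrite expnS expn1; nia.
(* The induction hypothesis is used up to [4 X], where [sum_pair_sum] ends. *)
have QX4 : (Q <= 4 * X)%N by lia.
have {IH} IH := IH _ _ YZ2 T2 QX4.
have l0 : 0 < ln T%:R :> R by have := @ln_nat_ge_half _ T1; lra.
have lT2 : ln (T ^ 2)%:R = 2 * ln T%:R :> R.
  by rewrite ln_natX ?(ltnW T1) // mulr_natl.
pose K := cutoff_const k; have K1 : 1 <= K := cutoff_const_ge1 k.
have Kl0 : 0 < K * ln T%:R by rewrite mulr_gt0 //; lra.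
pose W j n : R := pair_sum (others Y j) (Y j) T n.
have W0 j n : 0 <= W j n by apply: pair_sum_ge0.
have hW j : \sum_(1 <= n < X.+1) W j n / n%:R
    <= transfer_const * smooth_const k * ln T%:R ^+ 2 * recsum S X.
  apply: le_trans (sum_pair_sum _ _ T1 (Y0 j)) _.
  rewrite (eq_bigl _ _ (fun n => esym (boxedE Y j n))).
  have h4 : recsum S (4 * X) <= 17 ^+ 2 * recsum S X :> R.
    by have := recsum_pow2 2 Sm Sg QX; rewrite (_ : (2 ^ 2 = 4)%N).
  rewrite lT2 in IH.
  have C0 := smooth_const_ge0 k.
  apply: (@le_trans _ _ (72 * ln T%:R * (10200 * (smooth_const k * (2 * ln T%:R) * (17 ^+ 2 * recsum S X))))).
    rewrite ler_wpM2l ?mulr_ge0 ?(ltW l0) // ler_wpM2l //; apply: le_trans IH _.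
    by rewrite ler_wpM2l // mulr_ge0 // mulr_ge0 // ltW.
  rewrite le_eqVlt; apply/orP; left; apply/eqP; rewrite /transfer_const.
  by move: (17 ^+ 2 : R) (smooth_const k) => x y; ring.
have hV := sum_small_cofactors S X T1.
pose A : R := k%:R * ((K + 1) * ln T%:R).
have main : \sum_(1 <= n < X.+1 | S n) smoothln T n / n%:R <=
    A * recsum S X + (\sum_j \sum_(1 <= n < X.+1) W j n / n%:R) / (K * ln T%:R)
    + 9 * ln T%:R * recsum S X.
  apply: le_trans (lerD (lexx _) hV).
  rewrite exchange_big /= mulr_suml /recsum mulr_sumr.
  rewrite [leLHS]big_mkcond [X in _ <= X + _ + _]big_mkcond -!big_split /=.
  apply: ler_sum_nat => n /andP[n0 _].
  have hWn : 0 <= (\sum_j W j n / n%:R) / (K * ln T%:R).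
    by rewrite divr_ge0 ?(ltW Kl0) // sumr_ge0 // => j _; rewrite divr_ge0.
  case: ifP => Sn; last first.
    by rewrite add0r addr_ge0 // divr_ge0 // sumr_ge0 // => b _; apply: mangoldt_ge0.
  have [d [dY dn h]] := split_n T n n0 Sn.
  rewrite -mulr_suml [X in _ + X + _]mulrAC -!mulrDl ler_wpM2r ?invr_ge0 //.
  apply: le_trans h _; rewrite lerD2r mulr_suml.
  have -> : A = \sum_(j < k) (K + 1) * ln T%:R by rewrite sumr_const card_ord -[RHS]mulr_natl.
  rewrite -big_split /=; apply: ler_sum => j _.
  (* Beyond the cutoff, [smoothln T (d j) - ln T] exceeds [K ln T], so [smoothln T (d j)] is at most
     the pair sum divided by [K ln T]. *)
  have [hs|hs] := leP (smoothln T (d j)) ((K + 1) * ln T%:R).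
    by apply: le_trans hs _; rewrite ler_wpDr // divr_ge0 // ltW.
  apply: ler_wpDl; first by rewrite mulr_ge0 ?(ltW l0) //; lra.
  rewrite ler_pdivlMr //; apply: le_trans (@pair_sum_ge (others Y j) _ _ _ (\prod_(i | i != j) d i)%N (d j) _ _ _ _ _) => //.
  - by rewrite ler_wpM2l ?smoothln_ge0 //; lra.
  - exact: ltnW.
  - by exists d; split.
  - by move: dn; rewrite (bigD1 j) //= mulnC.
apply: le_trans main _.
have hWs : (\sum_j \sum_(1 <= n < X.+1) W j n / n%:R) / (K * ln T%:R)
    <= smooth_const k / 2 * ln T%:R * recsum S X.
  rewrite ler_pdivrMr //.
  apply: (@le_trans _ _ (\sum_(j < k) transfer_const * smooth_const k * ln T%:R ^+ 2 * recsum S X)).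
    by apply: ler_sum => j _; apply: hW.
  rewrite sumr_const card_ord -[leLHS]mulr_natl.
  rewrite [leRHS](_ : _ = (K / 2) * (smooth_const k * ln T%:R ^+ 2 * recsum S X)); last by field.
  rewrite [leLHS](_ : _ = (transfer_const * k%:R) * (smooth_const k * ln T%:R ^+ 2 * recsum S X)); last by ring.
  have E0 : 0 <= smooth_const k * ln T%:R ^+ 2 * recsum S X.
    apply: mulr_ge0; last exact: recsum_ge0.
    by apply: mulr_ge0; rewrite ?smooth_const_ge0 ?exprn_ge0 ?(ltW l0).
  apply: (ler_wpM2r E0).
  by rewrite /K /cutoff_const; lra.
apply: (@le_trans _ _ (A * recsum S X + smooth_const k / 2 * ln T%:R * recsum S X + 9 * ln T%:R * recsum S X)).
  by rewrite lerD2r lerD2l.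
rewrite le_eqVlt; apply/orP; left; apply/eqP; rewrite /A /smooth_const -/K.
by field.
Qed.

Definition shift_const k : R := 17 ^+ 2 * (9 * 10200 * smooth_const k).

Lemma shift_const_ge1 k : 1 <= shift_const k.
Proof.
have h1 : 1 <= 17 ^+ 2 :> R by rewrite exprn_ege1 // ler1n.
have h2 : 1 <= 9 * 10200 :> R by rewrite -natrM ler1n.
have h3 : 1 <= smooth_const k :> R.
  have h : 0 <= k%:R * (cutoff_const k + 1).
    by rewrite mulr_ge0 // addr_ge0 // (le_trans _ (cutoff_const_ge1 k)).
  by rewrite /smooth_const; lra.
have mul1 (x y : R) : 1 <= x -> 1 <= y -> 1 <= x * y by move=> *; nra.
exact: mul1 h1 (mul1 _ _ h2 h3).
Qed.

(** [shift_coordinate] ends at [2 ^ (a + 2)] times the old bound. As [2 ^ a Y' j <= Y j], this is at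
    most four times the new one: two doublings, hence the factor [17 ^+ 2] in [shift_const]. *)
Lemma shift_one k (Y Y' : 'I_k -> nat) j a M :
  (forall i, i != j -> Y' i = Y i) -> Y' j = (Y j %/ 2 ^ a)%N ->
  (0 < Y' j)%N -> (forall i, 0 < Y i)%N -> (0 < M)%N ->
  recsum (boxed Y') (M * \prod_i Y' i) <=
    shift_const k * a.+2%:R * recsum (boxed Y) (M * \prod_i Y i).
Proof.
move=> eqY Y'j Y'0 Y0 M0; have C1 := shift_const_ge1 k.
have [a0|a0] := posnP a.
  have -> : Y' = Y.
    by apply/funext => i; have [->|/eqY//] := eqVneq i j; rewrite Y'j a0 divn1.
  rewrite ler_peMl ?recsum_ge0 // a0; lra.
have Z0 : (0 < 2 ^ a)%N by rewrite expn_gt0.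
have hY : (Y' j * 2 ^ a <= Y j < Y' j * 2 ^ a.+1)%N.
  rewrite Y'j leq_divM /= expnS mulnCA mulnC; have := ltn_ceil (Y j) Z0.
  by rewrite -Y'j; nia.
have [hY1 hY2] := andP hY.
have eqO : others Y' j = others Y j.
  apply/funext => e; apply/propext; split=> -[d [dY ->]]; exists d; split=> // i ij.
    by rewrite -eqY ?dY.
  by rewrite eqY ?dY.
have E' : recsum (boxed Y') =1 recsum (multiples (others Y j) (Y' j)) :> (nat -> R).
  by move=> X; apply: eq_bigl => n; rewrite (boxedE Y' j) eqO.
have E : recsum (boxed Y) =1 recsum (multiples (others Y j) (Y j)) :> (nat -> R).
  by move=> X; apply: eq_bigl => n; rewrite (boxedE Y j).
have PY : (\prod_i Y i = Y j * \prod_(i | i != j) Y i)%N by rewrite (bigD1 j).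
have PY' : (\prod_i Y' i = Y' j * \prod_(i | i != j) Y i)%N.
  by rewrite (bigD1 j) //=; congr (_ * _)%N; apply: eq_bigr.
set O := (\prod_(i | i != j) Y i)%N in PY PY'.
have Yj1 : (1 < Y j)%N.
  apply: leq_trans hY1; apply: (@leq_trans (1 * 2 ^ 1)%N) => //.
  by rewrite leq_mul // leq_exp2l.
set X := (M * \prod_i Y' i)%N.
have QX : (\prod_i Y i <= 2 ^ (a + 2) * X)%N.
  rewrite /X PY PY' (leq_trans (leq_mul (ltnW hY2) (leqnn O))) //.
  rewrite addn2 (expnS 2 a.+1); apply: (@leq_trans (2 ^ a.+1 * (Y' j * O))%N); first by apply: eq_leq; ring.
  by rewrite leq_mul ?leq_pmull ?leq_pmull.
rewrite E' E; apply: le_trans (shift_coordinate (C := smooth_const k) a0 Y'0 hY _) _.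
  rewrite -E -(eq_bigl _ _ (boxedE Y j)).
  exact: smoothln_average.
have -> : shift_const k * a.+2%:R * recsum (multiples (others Y j) (Y j)) (M * \prod_i Y i)
    = 9 * 10200 * smooth_const k * a.+2%:R * (17 ^+ 2 * recsum (boxed Y) (M * \prod_i Y i)) :> R.
  by rewrite -E /shift_const; move: (17 ^+ 2 : R) => x; ring.
have c0 : 0 <= 9 * 10200 * smooth_const k * a.+2%:R :> R.
  apply: mulr_ge0 => //; apply: mulr_ge0; last exact: smooth_const_ge0.
  by rewrite -natrM.
apply: (ler_wpM2l c0).
have QM : (\prod_i Y i <= M * \prod_i Y i)%N by rewrite leq_pmull.
rewrite -E; apply: le_trans (recsum_pow2 2 (@boxed_closed _ Y) (@boxed_generated _ Y) QM).
apply: recsum_le; rewrite /X PY PY' expnD.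
rewrite (_ : 2 ^ a * 2 ^ 2 * (M * (Y' j * O)) = 2 ^ 2 * (M * ((Y' j * 2 ^ a) * O)))%N; last by ring.
by rewrite !leq_mul.
Qed.

Lemma shift_all k (Y a : 'I_k -> nat) M :
  (forall i, 0 < Y i %/ 2 ^ a i)%N -> (0 < M)%N ->
  recsum (boxed (fun i => Y i %/ 2 ^ a i)%N) (M * \prod_i (Y i %/ 2 ^ a i)) <=
    (\prod_i (shift_const k * (a i).+2%:R)) * recsum (boxed Y) (M * \prod_i Y i).
Proof.
move=> Ya0 M0; set Ya := (fun i => Y i %/ 2 ^ a i)%N.
have Y0 i : (0 < Y i)%N by apply: leq_trans (Ya0 i) (leq_div _ _).
(* The first [t] coordinates are already restored; they are changed one at a time. *)
pose Z t (i : 'I_k) := if (i < t)%N then Y i else Ya i.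
have step t : (t <= k)%N -> recsum (boxed Ya) (M * \prod_i Ya i) <=
    (\prod_(i < k | (i < t)%N) (shift_const k * (a i).+2%:R)) * recsum (boxed (Z t)) (M * \prod_i Z t i).
  elim: t => [_|t IH tk].
    by rewrite [X in X * _]big_pred0 // mul1r (_ : Z 0%N = Ya).
  apply: le_trans (IH (ltnW tk)) _; pose j := Ordinal tk.
  rewrite [X in _ <= X * _](bigD1 j) //= [X in _ <= X * _]mulrC -mulrA.
  rewrite [X in _ <= X * _](eq_bigl (fun i : 'I_k => (i < t)%N)); last first.
    move=> i; rewrite ltnS leq_eqVlt -val_eqE /=.
    by case: (ltngtP i t).
  rewrite ler_wpM2l //.
    by apply: prodr_ge0 => i _; rewrite mulr_ge0 // (le_trans _ (shift_const_ge1 k)).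
  apply: (@shift_one k (Z t.+1) (Z t) j) => //.
  - by move=> i; rewrite /Z ltnS -val_eqE /=; case: (ltngtP i t).
  - by rewrite /Z /= ltnn ltnS leqnn.
  - by rewrite /Z /= ltnn; apply: Ya0.
  - by move=> i; rewrite /Z; case: ifP => _; [apply: Y0|apply: Ya0].
have := step k (leqnn k).
rewrite (_ : Z k = Y); last by apply/funext => i; rewrite /Z ltn_ord.
rewrite [X in X * _](eq_bigl xpredT); first by [].
by move=> i; rewrite ltn_ord.
Qed.

(** * Comparing products with multiples *)

Definition products k (Y : 'I_k -> nat) M : pred nat := fun p =>
  `[< exists (n : 'I_k -> nat) m, [/\ forall i, (0 < n i <= Y i)%N, (0 < m <= M)%N
       & p = (\prod_i n i * m)%N] >].

Lemma ln_box_le k (Y : 'I_k -> nat) M X : (forall i, 0 < Y i <= M)%N -> (1 < M)%N ->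
  (0 < X)%N -> (X <= M * \prod_i Y i)%N ->
  12 * ln X%:R + 2 <= (12 * k.+1%:R + 4) * ln M%:R :> R.
Proof.
move=> YM M1 X0 XM; have l := @ln_nat_ge_half _ M1.
have : ln X%:R <= ln (M ^ k.+1)%:R :> R.
  apply: ler_ln_nat => //; apply: leq_trans XM _; rewrite expnS leq_mul //.
  rewrite -[k in (M ^ k)%N]card_ord -prod_nat_const.
  by apply: leq_prod => i _; have /andP[] := YM i.
by rewrite ln_natX ?(ltnW M1) // -(mulr_natl (ln _)); nra.
Qed.

Lemma sum_weighted_pow2 B : \sum_(a < B) (a.+2%:R / (2 ^ a)%:R) <= 6 :> R.
Proof.
(* The right-hand side is the exact value of the partial sum, so induction applies. *)
suff : \sum_(a < B) (a.+2%:R / (2 ^ a)%:R) <= 6 - (B%:R + 3) * 2 / (2 ^ B)%:R :> R.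
  move=> /le_trans; apply; rewrite lerBlDr lerDl.
  by rewrite divr_ge0 // mulr_ge0 // addr_ge0.
elim: B => [|B IH]; first by rewrite big_ord0 expn0 divr1; lra.
rewrite big_ord_recr /=; apply: le_trans (lerD IH (lexx _)) _.
have P0 : (2 ^ B)%:R != 0 :> R by rewrite pnatr_eq0 -lt0n expn_gt0.
rewrite expnS natrM -[B.+2]addn2 -[B.+1]addn1 !natrD.
rewrite le_eqVlt; apply/orP; left; apply/eqP; field.
by rewrite P0.
Qed.

(** The 5 is from [card_upto_upper], each coordinate costs [6 * shift_const k] after summing over
    its dyadic shifts, and the last factor is from [ln_box_le]. *)
Definition upper_const k : R := 5 * (6 * shift_const k) ^+ k * (12 * k.+1%:R + 4).

(** A factor [n i] is dyadic for [Y i / 2 ^ f i] with some [f i]. The shorter range gains [2 ^ f i]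
    in each coordinate and [shift_all] loses only a multiple of [f i + 2], so the sum over all [f]
    converges; [card_upto_lower] then returns to a count. *)
Lemma products_upper k (Y : 'I_k -> nat) M X :
  (forall i, 0 < Y i <= M)%N -> (1 < M)%N ->
  card_upto (products Y M) X <= upper_const k * card_upto (boxed Y) (M * \prod_i Y i).
Proof.
move=> YM M1; have M0 := ltnW M1; have C1 := shift_const_ge1 k.
have Y0 i : (0 < Y i)%N by have /andP[] := YM i.
have l0 : 0 < ln M%:R :> R by have := @ln_nat_ge_half _ M1; lra.
(* Every shift that occurs is at most [Y i], hence at most [M]. *)
pose B := M.+1; pose Ya (f : {ffun 'I_k -> 'I_B}) i := (Y i %/ 2 ^ f i)%N.
pose ok f := [forall i, 0 < Ya f i]%N.
have cover : card_upto (products Y M) X <=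
    \sum_(f | ok f) card_upto (boxed (Ya f)) (M * \prod_i Ya f i) :> R.
  pose Z := maxn X (M * \prod_i Y i).
  apply: (@le_trans _ _ (\sum_(1 <= p < Z.+1) \sum_(f | ok f)
     (boxed (Ya f) p && (p <= M * \prod_i Ya f i))%N%:R)).
    rewrite /card_upto; apply: sum_nat_subset => //; first by rewrite leq_maxl.
      by move=> p *; apply: sumr_ge0.
    move=> p p0 pX /asboolP[n [m [nY /andP[m0 mM] pE]]].
    have aB i : (trunc_log 2 (Y i %/ n i) < B)%N.
      have /andP[n0 nYi] := nY i; rewrite ltnS.
      have q0 : (0 < Y i %/ n i)%N by rewrite divn_gt0.
      have /andP[_ YiM] := YM i.
      apply: leq_trans YiM; apply: leq_trans (leq_div (Y i) (n i)).
      by apply: leq_trans (trunc_logP (isT : (1 < 2)%N) q0); rewrite ltnW // ltn_expl.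
    pose f := [ffun i => Ordinal (aB i)].
    have dy i : dyadic (Ya f i) (n i).
      have /andP[n0 nYi] := nY i; rewrite /Ya ffunE /=.
      have q0 : (0 < Y i %/ n i)%N by rewrite divn_gt0.
      have [h1 h2] := andP (trunc_log_bounds (isT : (1 < 2)%N) q0).
      move: h1 h2; set t := trunc_log 2 _ => h1 h2.
      rewrite /dyadic leq_divRL ?expn_gt0 // ltn_divLR ?expn_gt0 //.
      rewrite leq_divRL // in h1; rewrite mulnC h1 /=.
      by rewrite ltn_divLR // expnS in h2; rewrite mulnAC.
    have okf : ok f.
      apply/forallP => i; have /andP[h _] := dy i; have /andP[h0 _] := nY i.
      exact: leq_trans h0 h.
    rewrite (bigD1 f) //=.
    suff -> : boxed (Ya f) p && (p <= M * \prod_i Ya f i)%N.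
      by rewrite ler_wpDr // sumr_ge0.
    apply/andP; split.
      by apply/asboolP; exists n; split => //; rewrite pE dvdn_mulr.
    rewrite pE mulnC leq_mul //; apply: leq_prod => i _.
    by have /andP[] := dy i.
  rewrite exchange_big /=; apply: ler_sum => f okf.
  have -> : \sum_(1 <= p < Z.+1) (boxed (Ya f) p && (p <= M * \prod_i Ya f i))%N%:R
      = \sum_(1 <= p < Z.+1 | boxed (Ya f) p && (p <= M * \prod_i Ya f i)%N) 1 :> R.
    by rewrite [RHS]big_mkcond; apply: eq_bigr => p _; case: ifP.
  rewrite /card_upto [leRHS](big_nat_widen _ _ Z.+1) // ltnS leq_max; apply/orP; right.
  by rewrite leq_mul // leq_prod // => i _; rewrite leq_div.
set Q := (\prod_i Y i)%N in cover *; set L : R := recsum (boxed Y) (M * Q).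
have L0 : 0 <= L by apply: recsum_ge0.
have each f : ok f -> card_upto (boxed (Ya f)) (M * \prod_i Ya f i) * ln M%:R <=
    5 * (M * Q)%:R * L * \prod_i (shift_const k * ((f i).+2%:R / (2 ^ f i)%:R)).
  move=> /forallP okf.
  have := @card_upto_upper _ _ (M * \prod_i Ya f i) M (@boxed_closed _ (Ya f)) (@boxed_generated _ (Ya f)) M0.
  move=> h; apply: le_trans (h _) _; first by rewrite mulnC.
  apply: le_trans (ler_wpM2l _ (shift_all okf M0)) _; first by rewrite mulr_ge0.
  rewrite -/Q -/L.
  have hP : (\prod_i Ya f i)%:R <= Q%:R * \prod_i ((2 ^ f i)%:R^-1 : R).
    rewrite !natr_prod -big_split /=; apply: ler_prod => i _.
    by rewrite ler0n /= natr_divn_le.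
  set A := \prod_i (shift_const k * _).
  have A0 : 0 <= A.
    by apply: prodr_ge0 => i _; rewrite mulr_ge0 // (le_trans _ C1).
  have -> : \prod_i (shift_const k * ((f i).+2%:R / (2 ^ f i)%:R)) = A * \prod_i ((2 ^ f i)%:R^-1 : R).
    by rewrite -big_split /=; apply: eq_bigr => i _; rewrite mulrA.
  rewrite !natrM; move: hP; move: (\prod_i Ya f i)%:R (\prod_i (2 ^ f i)%:R^-1) => x y hP.
  rewrite [leRHS](_ : _ = (5 * M%:R * (A * L)) * (Q%:R * y)); last by ring.
  rewrite [leLHS](_ : _ = (5 * M%:R * (A * L)) * x); last by ring.
  by rewrite ler_wpM2l // !mulr_ge0.
have hsum : \sum_(f : {ffun 'I_k -> 'I_B}) \prod_i (shift_const k * ((f i).+2%:R / (2 ^ f i)%:R))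
    <= (6 * shift_const k) ^+ k.
  rewrite -(bigA_distr_bigA (fun (i : 'I_k) (t : 'I_B) => shift_const k * (t.+2%:R / (2 ^ t)%:R))).
  apply: (@le_trans _ _ (\prod_(i < k) (6 * shift_const k))); last by rewrite prodr_const card_ord.
  apply: ler_prod => i _; rewrite -mulr_sumr (mulrC 6).
  have s0 : 0 <= shift_const k by apply: le_trans C1.
  rewrite ler_wpM2l ?sum_weighted_pow2 // andbT mulr_ge0 // sumr_ge0 // => t _.
  by rewrite divr_ge0.
have MQ0 : (0 < M * Q)%N by rewrite muln_gt0 M0 prodn_gt0.
have low := @card_upto_lower _ (M * Q) (@boxed_closed _ Y).
have lbox := ln_box_le YM M1 MQ0 (leqnn _).
have C0 : 0 <= (6 * shift_const k) ^+ k :> R.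
  by rewrite exprn_ge0 // mulr_ge0 // (le_trans _ C1).
rewrite -(ler_pM2r l0).
apply: (@le_trans _ _ (5 * (M * Q)%:R * L * (6 * shift_const k) ^+ k)).
  apply: le_trans (ler_wpM2r (ltW l0) cover) _; rewrite mulr_suml.
  apply: le_trans (ler_sum _ each) _; rewrite -mulr_sumr ler_wpM2l ?mulr_ge0 //.
  apply: le_trans hsum; rewrite big_mkcond; apply: ler_sum => f _; case: ifP => // _.
  by apply: prodr_ge0 => i _; rewrite mulr_ge0 ?divr_ge0 // (le_trans _ C1).
rewrite [leLHS](_ : _ = 5 * (6 * shift_const k) ^+ k * ((M * Q)%:R * L)); last by ring.
apply: le_trans (ler_wpM2l _ low) _; first by rewrite mulr_ge0.
rewrite /upper_const.
rewrite [leRHS](_ : _ = 5 * (6 * shift_const k) ^+ k * (((12 * k.+1%:R + 4) * ln M%:R) * card_upto (boxed Y) (M * Q))); last by ring.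
by rewrite ler_wpM2l ?mulr_ge0 // ler_wpM2r ?card_upto_ge0.
Qed.

(** Each of [2 k + 2] doublings costs 2 for the length and 17 for [recsum]. The last summand takes
    care of [M < 2 ^ k]. *)
Definition lower_const k : R :=
  5 * 34 ^+ (2 * k + 2) * (12 * k.+1%:R + 4) + (2 ^ (k.+1 + k * k.+1))%:R.

Lemma card_upto_le_nat S X : card_upto S X <= X%:R :> R.
Proof.
apply: (@le_trans _ _ (\sum_(1 <= n < X.+1) 1)); first exact: sum_nat_subset.
by rewrite sumr_const_nat subn1.
Qed.

(** Members of the box up to [X1], which is [M Q / 2 ^ k], are products with cofactor at most [M].
    The upper bound at [X], doubling, and the lower bound at [X1] show that few members are lost. *)
Lemma products_lower k (Y : 'I_k -> nat) M X :
  (forall i, 0 < Y i <= M)%N -> (1 < M)%N ->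
  (M * \prod_i Y i <= X <= 2 ^ k.+1 * (M * \prod_i Y i))%N ->
  card_upto (boxed Y) X <= lower_const k * card_upto (products Y M) X.
Proof.
move=> YM M1; have M0 := ltnW M1.
have Y0 i : (0 < Y i)%N by have /andP[] := YM i.
set Q := (\prod_i Y i)%N => /andP[QX XQ].
have Q0 : (0 < Q)%N by apply: prodn_gt0.
have X0 : (0 < X)%N by apply: leq_trans QX; rewrite muln_gt0 M0.
have c1 : 0 <= 5 * 34 ^+ (2 * k + 2) * (12 * k.+1%:R + 4) :> R.
  by rewrite mulr_ge0 ?addr_ge0 ?mulr_ge0 ?exprn_ge0.
(* For [M < 2 ^ k] the count is bounded in terms of [k], and 1 is always a product. Otherwise
   [X1 >= Q], as doubling requires. *)
have [Mk|Mk] := ltnP M (2 ^ k).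
  have A1 : 1 <= card_upto (products Y M) X :> R.
    rewrite /card_upto big_ltn_cond // (_ : products Y M 1) ?ler_wpDr ?sumr_ge0 //.
    apply/asboolP; exists (fun=> 1%N), 1%N; split=> [i||]; first exact: Y0.
      by rewrite M0.
    by rewrite prod_nat_const exp1n.
  apply: le_trans (card_upto_le_nat _ _) _.
  apply: (@le_trans _ _ (lower_const k)); last first.
    by rewrite ler_peMr // /lower_const addr_ge0.
  rewrite /lower_const ler_wpDl // ler_nat; apply: leq_trans XQ _.
  rewrite expnD leq_mul // mulnS expnD leq_mul //; first exact: ltnW.
  rewrite expnM; apply: (@leq_trans (M ^ k)%N); last first.
    by have [->|k0] := posnP k; rewrite ?expn0 // leq_exp2r // ltnW.
  rewrite /Q -[k in (M ^ k)%N]card_ord -prod_nat_const.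
  by apply: leq_prod => i _; have /andP[] := YM i.
set S := boxed Y; set X1 := (M * Q %/ 2 ^ k)%N.
have P0 : (0 < 2 ^ k)%N by rewrite expn_gt0.
have QX1 : (Q <= X1)%N by rewrite leq_divRL // mulnC leq_mul.
have X10 : (0 < X1)%N by apply: leq_trans QX1.
(* [k + 1] doublings come from the range of [X], [k] from the division by [2 ^ k], and one from its
   rounding. *)
have XX1 : (X <= 2 ^ (2 * k + 2) * X1)%N.
  apply: leq_trans XQ _.
  have : (M * Q <= 2 ^ k * 2 * X1)%N by have := ltn_ceil (M * Q) P0; rewrite -/X1; nia.
  move=> h; apply: leq_trans (leq_mul (leqnn _) h) _.
  by apply: eq_leq; rewrite mul2n -addnn !expnD expnS; ring.
have X1X : (X1 <= X)%N by apply: leq_trans (leq_div _ _) QX.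
have l0 : 0 < ln M%:R :> R by have := @ln_nat_ge_half _ M1; lra.
have Sm : mult_closed S by apply: boxed_closed.
have Sg : generated_below S Q by apply: boxed_generated.
have sub : card_upto S X1 <= card_upto (products Y M) X :> R.
  apply: sum_nat_subset => // n n0 nX1 /asboolP[d [dY /dvdnP[m nE]]].
  have d0 i : (0 < d i)%N by have := dY i; case: (d i) => //; rewrite /dyadic muln0 andbF.
  apply/asboolP; exists d, m; split; last by rewrite mulnC.
    by move=> i; rewrite d0; have /andP[] := dY i.
  have m0 : (0 < m)%N by case: m nE n0 => // ->; rewrite mul0n.
  (* Each [Y i] is below [2 d i], so [m Q <= 2 ^ k n <= M Q]. *)
  rewrite m0 /= -(leq_pmul2r Q0); apply: (@leq_trans (n * 2 ^ k)%N).
    rewrite nE -mulnA leq_mul // mulnC -[k in (2 ^ k)%N]card_ord -prod_nat_const -big_split /=.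
    by apply: leq_prod => i _; have /andP[_ /ltnW] := dY i.
  by move: nX1; rewrite leq_divRL.
have up := @card_upto_upper S Q X M Sm Sg M0.
rewrite mulnC in up; have {}up := up QX.
have low := @card_upto_lower _ X1 Sm.
have lbox := ln_box_le YM M1 X10 (leq_div _ _).
apply: (@le_trans _ _ (5 * 34 ^+ (2 * k + 2) * (12 * k.+1%:R + 4) * card_upto S X1)); last first.
  apply: le_trans (ler_wpM2l c1 sub) _; rewrite ler_wpM2r ?card_upto_ge0 //.
  by rewrite /lower_const lerDl.
rewrite -(ler_pM2r l0); apply: le_trans up _.
apply: (@le_trans _ _ (5 * (2 ^ (2 * k + 2) * X1)%:R * (17 ^+ (2 * k + 2) * recsum S X1))).
  apply: (@le_trans _ _ (5 * (2 ^ (2 * k + 2) * X1)%:R * recsum S X)).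
    by rewrite ler_wpM2r ?recsum_ge0 // ler_wpM2l // ler_nat.
  rewrite ler_wpM2l ?mulr_ge0 //; apply: le_trans (recsum_pow2 (2 * k + 2) Sm Sg QX1).
  exact: recsum_le.
rewrite [leLHS](_ : _ = 5 * 34 ^+ (2 * k + 2) * (X1%:R * recsum S X1)); last first.
  rewrite (_ : 34 = 2 * 17) ?exprMn ?natrM ?natrX; last by lra.
  by ring.
apply: le_trans (ler_wpM2l _ low) _; first by rewrite mulr_ge0 ?exprn_ge0.
rewrite [leRHS](_ : _ = 5 * 34 ^+ (2 * k + 2) * ((12 * k.+1%:R + 4) * ln M%:R * card_upto S X1)); last by ring.
by rewrite ler_wpM2l ?mulr_ge0 ?exprn_ge0 // ler_wpM2r ?card_upto_ge0.
Qed.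

(** * The two counts in terms of integer parts *)

Lemma count_card_upto (P : pred nat) X : ~~ P 0%N ->
  (count P (iota 0 X.+1))%:R = card_upto P X :> R.
Proof.
move=> /negbTE P0; rewrite /= P0 add0n /card_upto /index_iota subn1 /=.
by rewrite -sum1_count natr_sum.
Qed.

Lemma H_countE k (N : 'I_k -> R) x : (forall i, 0 <= N i) -> 0 <= x ->
  (H_count x (fun i => N i / 2) N)%:R
  = card_upto (boxed (fun i => Num.truncn (N i))) (Num.truncn x) :> R.
Proof.
move=> N0 x0; rewrite /H_count count_card_upto // /card_upto.
rewrite big_nat_cond [RHS]big_nat_cond; apply: eq_bigl => n.
apply: andb_id2l => /andP[n0 nX]; rewrite ltnS truncn_ge_nat // in nX; rewrite n0 nX /=.
(* [N i] may be replaced by its integer part, since it is compared with the integers [d] and [2 d]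
   only. *)
have E i (d : nat) : (N i / 2 < d%:R) && (d%:R <= N i) = dyadic (Num.truncn (N i)) d.
  rewrite /dyadic truncn_ge_nat // truncn_lt_nat // natrM andbC.
  by rewrite ltr_pdivrMr // mulrC.
apply/existsP/asboolP => [[d /andP[/forallP h dn]]|[d [dY dn]]].
  exists (fun i => d i : nat); split => // i; rewrite -E.
  by have /andP[/andP[_ ->] ->] := h i.
have d0 i : (0 < d i)%N by have := dY i; case: (d i) => //; rewrite /dyadic muln0 andbF.
have dle i : (d i < n.+1)%N.
  by rewrite ltnS dvdn_leq // (dvdn_trans _ dn) // (bigD1 i) //= dvdn_mulr.
exists [ffun i => Ordinal (dle i)]; apply/andP; split.
  by apply/forallP => i; rewrite ffunE /= d0 /= E; apply: dY.
by under eq_bigr => i _ do rewrite ffunE.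
Qed.

Lemma A_countE k (N : 'I_k.+1 -> R) : (forall i, 0 <= N i) ->
  (A_count N)%:R
  = card_upto (products (fun i : 'I_k => Num.truncn (N (widen_ord (leqnSn k) i)))
                        (Num.truncn (N ord_max)))
      (Num.truncn (\prod_(i < k.+1) N i)) :> R.
Proof.
move=> N0; rewrite /A_count; set B := Num.truncn (\prod_i N i).
rewrite count_card_upto; last first.
  apply/existsP => -[n /andP[/forallP h /eqP p0]].
  have : (0 < \prod_i n i)%N by apply: prodn_gt0 => i; have /andP[] := h i.
  by rewrite -p0.
rewrite /card_upto big_nat_cond [RHS]big_nat_cond; apply: eq_bigl => p.
apply: andb_id2l => /andP[p0 pB].
apply/existsP/asboolP => [[n /andP[/forallP h /eqP ->]]|[n [m [nY mM pE]]]].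
  have hn i : (0 < n i <= Num.truncn (N i))%N by rewrite truncn_ge_nat //; apply: h.
  exists (fun i => n (widen_ord (leqnSn k) i) : nat), (n ord_max : nat).
  by split => //; rewrite big_ord_recr.
pose g (i : 'I_k.+1) := if unlift ord_max i is Some j then n j else m.
have wE j : widen_ord (leqnSn k) j = lift ord_max j by apply: val_inj; rewrite [RHS]lift_max.
have gw j : g (widen_ord (leqnSn k) j) = n j by rewrite /g wE liftK.
have gm : g ord_max = m by rewrite /g unlift_none.
have pg : p = (\prod_i g i)%N.
  by rewrite big_ord_recr /= gm pE; congr (_ * _)%N; apply: eq_bigr => j _; rewrite gw.
have hg i : (0 < g i <= Num.truncn (N i))%N.
  have [j ->|->] := unliftP ord_max i; last by rewrite gm.
  by rewrite -wE gw.
(* The other factors are positive, so each factor is at most [p], which is at most [B]. *)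
have gB i : (g i < B.+1)%N.
  apply: leq_trans pB; rewrite ltnS pg (bigD1 i) //= leq_pmulr // prodn_cond_gt0 // => j _.
  by have /andP[] := hg j.
exists [ffun i => Ordinal (gB i)]; apply/andP; split.
  by apply/forallP => i; rewrite ffunE /= -truncn_ge_nat.
by rewrite pg; under [X in _ == X]eq_bigr => i _ do rewrite ffunE.
Qed.

End Boxes.

End Factorizations.

Unset Implicit Arguments.

Theorem theorem1p1 (R : realType) (k : nat) (hk : (1 <= k)%N) :
  exists c1 c2 : R, 0 < c1 /\ 0 < c2 /\
  forall N : 'I_k.+1 -> R,
    3 <= N ord0 ->
    (forall i j : 'I_k.+1, (i <= j)%N -> N i <= N j) ->
    let H := H_count (\prod_(i < k.+1) N i)
                     (fun i : 'I_k => N (widen_ord (leqnSn k) i) / 2)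
                     (fun i : 'I_k => N (widen_ord (leqnSn k) i)) in
    c1 * (H%:R) <= (A_count N)%:R /\ (A_count N)%:R <= c2 * (H%:R).
Proof.
have up0 : 0 < upper_const R k :> R.
  have := shift_const_ge1 R k => h; rewrite /upper_const mulr_gt0 ?mulr_gt0 ?exprn_gt0 //.
  - by rewrite mulr_gt0 // (lt_le_trans _ h).
  - by rewrite ltr_wpDl // mulr_ge0.
have lo0 : 0 < lower_const R k :> R.
  rewrite /lower_const ltr_wpDl ?ltr0n ?expn_gt0 //.
  by rewrite mulr_ge0 ?addr_ge0 ?mulr_ge0 ?exprn_ge0.
exists (lower_const R k)^-1, (upper_const R k); split; first by rewrite invr_gt0.
split => // N N3 Nmon H.
have hN i : 3 <= N i by apply: le_trans N3 (Nmon _ _ _).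
have N0 i : 0 <= N i by apply: le_trans (hN i).
have x0 : 0 <= \prod_(i < k.+1) N i by apply: prodr_ge0.
pose Y (i : 'I_k) := Num.truncn (N (widen_ord (leqnSn k) i)).
pose M := Num.truncn (N ord_max).
have M1 : (1 < M)%N.
  by rewrite /M truncn_ge_nat // (le_trans _ (hN _)) // ler_nat.
have YM i : (0 < Y i <= M)%N.
  rewrite truncn_gt0 (le_trans _ (hN _)) ?ler1n //=.
  by apply: le_truncn; apply: Nmon; rewrite /= ltnW.
have HE : H%:R = card_upto R (boxed Y) (Num.truncn (\prod_i N i)) :> R.
  by rewrite /H (@H_countE R k (fun i => N (widen_ord (leqnSn k) i))).
have AE := A_countE N0; rewrite -/M -[X in products X M]/Y in AE.
set X := Num.truncn _ in HE AE.
have PE : \prod_(i < k.+1) N i = (\prod_(i < k) N (widen_ord (leqnSn k) i)) * N ord_max.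
  by rewrite big_ord_recr.
have MX : (M * \prod_i Y i <= X)%N.
  rewrite /X truncn_ge_nat // PE mulnC natrM natr_prod ler_pM ?prodr_ge0 ?truncn_le //.
  by apply: ler_prod => i _; rewrite ler0n /= /Y truncn_le.
have XM : (X <= 2 ^ k.+1 * (M * \prod_i Y i))%N.
  (* With integer part [t >= 1], [z < t + 1 <= 2 t]; one factor 2 for each of the [k.+1]
     variables. *)
  have dbl (z : R) : 3 <= z -> z <= (2 * Num.truncn z)%:R.
    move=> z3; apply: le_trans (ltW (truncnS_gt z)) _; rewrite ler_nat.
    have : (0 < Num.truncn z)%N by rewrite truncn_gt0 (le_trans _ z3) ?ler1n.
    by move: (Num.truncn z) => t; lia.
  rewrite -(ler_nat R); apply: (@le_trans _ _ (\prod_(i < k.+1) N i)).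
    by rewrite truncn_le.
  rewrite PE (_ : 2 ^ k.+1 * (M * \prod_i Y i) = (\prod_i (2 * Y i)) * (2 * M))%N; last first.
    by rewrite big_split /= prod_nat_const card_ord expnS; ring.
  rewrite natrM natr_prod ler_pM ?prodr_ge0 ?dbl //.
  by apply: ler_prod => i _; rewrite N0 dbl.
rewrite HE AE; split.
  by rewrite mulrC ler_pdivrMr // mulrC; apply: products_lower => //; rewrite MX.
apply: le_trans (products_upper R X YM M1) _.
by rewrite ler_wpM2l ?(ltW up0) // card_upto_le.
Qed.
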